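(* Let $P$ be a pair of pants (oriented three-holed sphere) represented by a triple $(\alpha,\beta,\gamma)$ of elements of $\pi_1(P)$ corresponding to its boundary components, with $\alpha\gamma\beta=1$. Let $u,v,w$ be elements of the Weyl group of $\mathrm{PSL}(n,\mathbb R)$, identified with the group of permutations of $\{1,\dots,n\}$, one for each of the boundary components $\alpha,\beta,\gamma$. Assume that $$u(n)=n,\quad u(n-1)=1,\quad v(1)=1,\quad w(1)=n.$$ Let $\rho$ be an $n$-Hitchin representation of $\pi_1(P)$ into $\mathrm{PSL}(n,\mathbb R)$. Let $\xi$ be the Frenet curve with values in $\mathbb P(\mathbb R^n)$ associated to $\rho$ and $\xi^*$ its osculating hyperplane curve. Let $\mathbf B=\mathbf B_{\xi^*,\xi}$ be the cross ratio associated to the pair $(\xi^*,\xi)$. Then the pant gap function of the cross ratio $\mathbf B$ has the following expression in the Fock–Goncharov coordinates associated to the triple $(u,v,w)$: $$G_{\mathbf B}(P)=\log\left(\frac{1+C_1(\rho)\,e^{\ell_{\mathbf B}(\alpha)}}{1+C_1(\rho)}\right)=\log\left(\frac{1+B_{n-1}(\rho)}{B_{n-1}(\rho)\,(1+C_1(\rho))}\right).$$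
   Context: Pair of pants. $\alpha,\beta,\gamma\in\pi_1(P)$ are represented by loops freely homotopic to the three boundary loops oriented so that the attracting ($+$) and repelling ($-$) fixed points $(\alpha^-,\alpha^+,\beta^-,\beta^+,\gamma^-,\gamma^+)$ in $\partial_\infty\pi_1(P)$ are positively cyclically ordered, and $\alpha\gamma\beta=1$. $\partial_\infty\pi_1(P)$ is the limit set in $\partial\mathbb H^2$ of the holonomy of a hyperbolic metric with totally geodesic boundary on $P$. Hitchin representations. An element of $\mathrm{PSL}(n,\mathbb R)$ is purely loxodromic if all its eigenvalues are real and of multiplicity $1$. A homomorphism $\pi_1(P)\to\mathrm{PSL}(n,\mathbb R)$ is $n$-Fuchsian if it is a convex cocompact discrete faithful homomorphism into $\mathrm{PSL}(2,\mathbb R)$ composed with the irreducible homomorphism into $\mathrm{PSL}(n,\mathbb R)$; it is $n$-Hitchin if it may be continuously deformed into an $n$-Fuchsian one so that the images of the boundary components stay purely loxodromic. For Hitchin $\rho$, $\rho(\gamma)$ is purely loxodromic for every nontrivial $\gamma$. Frenet curve. A flag in $\mathbb R^n$ is a family $F=(F^1,\dots,F^{n-1})$, $\dim F^k=k$, $F^k\subset F^{k+1}$. A curve $\xi:\mathbb T\to\mathbb P(\mathbb R^n)$ on the circle is Frenet if there is a curve of flags $(\xi^1,\dots,\xi^{n-1})$ with $\xi^1=\xi$ (with $\xi^n=\mathbb R^n$) such that for pairwise distinct $x_i$ and positive integers $n_i$ with $\sum n_i\le n$ the sum $\sum_i\xi^{n_i}(x_i)$ is direct, and $\bigoplus_i\xi^{n_i}(y_i)\to\xi^{q}(x)$,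 $q=\sum n_i\le n$, when the $y_i$, all distinct, tend to $x$. $\xi^*=\xi^{n-1}$ is the osculating hyperplane curve. Any Hitchin representation $\rho$ of $\pi_1(P)$ extends to a Hitchin representation of the fundamental group of a closed surface containing $P$ (its double), which by Labourie preserves an equivariant Frenet curve on its boundary circle at infinity; the Frenet curve $\xi$ associated to $\rho$ is the restriction of this curve to $\partial_\infty\pi_1(P)$. The flag $(\xi^1(\eta^+),\dots,\xi^{n-1}(\eta^+))$ is the attracting flag of $\rho(\eta)$ for every nontrivial $\eta$. Cross ratio. $$\mathbf B_{\xi^*,\xi}(x,y,z,t)=\frac{\langle\widehat\xi^*(x)|\widehat\xi(y)\rangle\,\langle\widehat\xi^*(z)|\widehat\xi(t)\rangle}{\langle\widehat\xi^*(z)|\widehat\xi(y)\rangle\,\langle\widehat\xi^*(x)|\widehat\xi(t)\rangle},$$ where $\widehat\xi(u)$ is a nonzero vector of $\xi(u)$ and $\widehat\xi^*(u)$ a nonzero linear form with kernel $\xi^*(u)$. The period is $\ell_{\mathbf B}(\eta)=\log|\mathbf B(\eta^-,\eta y,\eta^+,y)|$ for any $y\neq\eta^\pm$. The pant gap function is $G_{\mathbf B}(P)=\log\mathbf B(\alpha^+,\gamma^-,\alpha^-,\beta^+)$. Fock–Goncharov coordinates. For a purely loxodromic $\mathrm M$ with eigenlines $L_1,\dots,L_n$ ordered by decreasing (absolute values of) eigenvalues and a permutation $u$, set $\mathrm M^u=(L_{u(1)},L_{u(1)}\oplus L_{u(2)},\dots)$. Let $X_\alpha=\rho(\alpha)^u$,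 $X_\beta=\rho(\beta)^v$, $X_\gamma=\rho(\gamma)^w$, and $Z_\gamma=\rho(\alpha)(X_\gamma)$, $Z_\beta=\rho(\alpha)^{-1}(X_\beta)=\rho(\gamma)(X_\beta)$. For flags $X,Y,Z,T$ in general position with bases $x,y,z,t$ adapted to them (i.e. $X^k$ is spanned by $x_1,\dots,x_k$, etc.), $\widehat x^{\,k}=x_1\wedge\dots\wedge x_k$, $\widehat x^{\,0}=1$, and $\Omega$ any volume form on $\mathbb R^n$, the edge functions are $$\delta_i(X,Y,Z,T)=\frac{\Omega(\widehat x^{i}\wedge\widehat z^{n-i-1}\wedge t_1)\,\Omega(\widehat x^{i-1}\wedge y_1\wedge\widehat z^{n-i})}{\Omega(\widehat x^{i}\wedge y_1\wedge\widehat z^{n-i-1})\,\Omega(\widehat x^{i-1}\wedge\widehat z^{n-i}\wedge t_1)},\quad 1\le i\le n-1.$$ The coordinates involved (superscripts $u,v,w$ omitted) are $C_1(\rho)=\delta_1(X_\beta,Z_\gamma,X_\alpha,X_\gamma)$ and $B_{n-1}(\rho)=\delta_{n-1}(X_\alpha,Z_\beta,X_\gamma,X_\beta)$. *)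

(* Defs.v *)
From HB Require Import structures.
From mathcomp Require Import all_boot all_order all_algebra perm.
From mathcomp Require Import all_classical all_reals all_analysis.

Set Implicit Arguments.
Unset Strict Implicit.
Unset Printing Implicit Defensive.

Import Order.TTheory GRing.Theory Num.Theory.
Import numFieldNormedType.Exports.

Local Open Scope classical_set_scope.
Local Open Scope quotient_scope.
Local Open Scope ring_scope.

Record sl (R : realType) (n : nat) : Type :=
  SL { slval : 'M[R]_n ; sl_det : \det slval == 1 }.

HB.instance Definition _ (R : realType) n := [isSub for @slval R n].
HB.instance Definition _ (R : realType) n := [Choice of sl R n by <:].

Section SpecialLinear.
Variables (R : realType) (n : nat).
Implicit Types x y z : sl R n.

Lemma sl_detE x : \det (slval x) = 1.
Proof. exact/eqP/sl_det. Qed.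

Lemma sl_unitmx x : slval x \in unitmx.
Proof. by rewrite unitmxE sl_detE unitr1. Qed.

Fact sl_one_subproof : \det (1%:M : 'M[R]_n) == 1.
Proof. by rewrite det1. Qed.
Definition sl_one : sl R n := SL sl_one_subproof.

Fact sl_mul_subproof x y : \det (slval x *m slval y) == 1.
Proof. by rewrite det_mulmx !sl_detE mulr1. Qed.
Definition sl_mul x y : sl R n := SL (sl_mul_subproof x y).

Fact sl_inv_subproof x : \det (invmx (slval x)) == 1.
Proof. by rewrite det_inv sl_detE invr1. Qed.
Definition sl_inv x : sl R n := SL (sl_inv_subproof x).

Fact sl_mulA : associative sl_mul.
Proof. by move=> x y z; apply: val_inj; rewrite /= mulmxA. Qed.
Fact sl_mul1 : left_id sl_one sl_mul.
Proof. by move=> x; apply: val_inj; rewrite /= mul1mx. Qed.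
Fact sl_mulr1 : right_id sl_one sl_mul.
Proof. by move=> x; apply: val_inj; rewrite /= mulmx1. Qed.
Fact sl_mulV : left_inverse sl_one sl_inv sl_mul.
Proof. by move=> x; apply: val_inj; rewrite /= mulVmx ?sl_unitmx. Qed.
Fact sl_mulVr : right_inverse sl_one sl_inv sl_mul.
Proof. by move=> x; apply: val_inj; rewrite /= mulmxV ?sl_unitmx. Qed.

HB.instance Definition _ :=
  isGroup.Build (sl R n) sl_mulA sl_mul1 sl_mulr1 sl_mulV sl_mulVr.

HB.instance Definition _ :=
  Topological.copy (sl R n) (initial_topology (@slval R n)).

(* When n is odd, - x never has determinant 1, so that the relation is then
   equality and PSL(n,R) = SL(n,R). *)
Definition sl_sign x y : bool :=
  (slval x == slval y) || (slval x == - slval y).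

Fact sl_sign_equiv : equiv_class_of sl_sign.
Proof.
rewrite /sl_sign; split=> [x|x y|y x z].
- by rewrite eqxx.
- by rewrite eq_sym; congr orb; rewrite -eqr_oppLR eq_sym.
- case/orP=> /eqP ->; first by [].
  by case/orP=> /eqP ->; rewrite ?opprK eqxx ?orbT.
Qed.

Canonical sl_sign_eq := EquivRelPack sl_sign_equiv.

Definition psl : Type := quotient_topology {eq_quot sl_sign_eq}.


HB.instance Definition _ := Topological.on psl.
HB.instance Definition _ := Quotient.on psl.

Definition slclass x : psl := \pi_psl x.
Definition slrep (a : psl) : sl R n := repr a.

Lemma slrepK a : slclass (slrep a) = a.
Proof. exact: reprK. Qed.

Lemma slclassP x y : reflect (slclass x = slclass y) (sl_sign x y).
Proof. exact: eqmodP. Qed.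

Lemma slclassM x x' y y' : slclass x = slclass x' -> slclass y = slclass y' ->
  slclass (x * y)%g = slclass (x' * y')%g.
Proof.
move=> /slclassP/orP xx' /slclassP/orP yy'; apply/slclassP/orP => /=.
case: xx' => /eqP ->; case: yy' => /eqP ->;
  rewrite ?mulmxN ?mulNmx ?opprK eqxx; by [left|right].
Qed.

Definition psl_mul (a b : psl) : psl := slclass (slrep a * slrep b)%g.
Definition psl_inv (a : psl) : psl := slclass (slrep a)^-1%g.

Lemma slclass_mul x y : psl_mul (slclass x) (slclass y) = slclass (x * y)%g.
Proof. by apply: slclassM; rewrite slrepK. Qed.

Fact psl_mulA : associative psl_mul.
Proof.
move=> a b c; rewrite -[a]slrepK -[b]slrepK -[c]slrepK.
by rewrite !slclass_mul mulgA.
Qed.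
Fact psl_mul1 : left_id (slclass 1%g) psl_mul.
Proof. by move=> a; rewrite -[a]slrepK slclass_mul mul1g. Qed.
Fact psl_mulr1 : right_id (slclass 1%g) psl_mul.
Proof. by move=> a; rewrite -[a]slrepK slclass_mul mulg1. Qed.
Fact psl_mulV : left_inverse (slclass 1%g) psl_inv psl_mul.
Proof. by move=> a; rewrite -{2}[a]slrepK slclass_mul mulVg. Qed.
Fact psl_mulVr : right_inverse (slclass 1%g) psl_inv psl_mul.
Proof. by move=> a; rewrite -{1}[a]slrepK slclass_mul mulgV. Qed.

HB.instance Definition _ :=
  isGroup.Build psl psl_mulA psl_mul1 psl_mulr1 psl_mulV psl_mulVr.

End SpecialLinear.

Section Subspaces.
Variables (R : realType) (n : nat).

Definition vimage m (M : 'M[R]_(n, m)) (U : {vspace 'cV[R]_m}) :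
  {vspace 'cV[R]_n} := (linfun (mulmx M) @: U)%VS.

(* Any two representatives in SL(n,R) act in the same way on subspaces. *)
Definition act (a : psl R n) (U : {vspace 'cV[R]_n}) : {vspace 'cV[R]_n} :=
  vimage (slval (slrep a)) U.

Lemma dim_act a U : \dim (act a U) = \dim U.
Proof.
apply/limg_dim_eq/eqP; rewrite -subv0; apply/subvP => v.
rewrite memv_cap memv_ker lfunE /= => /andP[_ /eqP av0].
by rewrite memv0 -[v](mulKmx (sl_unitmx (slrep a))) av0 mulmx0.
Qed.

Definition pspace : Type := {U : {vspace 'cV[R]_n} | \dim U == 1%N}.

Fact pact_subproof a (x : pspace) : \dim (act a (val x)) == 1%N.
Proof. by rewrite dim_act (valP x). Qed.
Definition pact a (x : pspace) : pspace :=
  exist _ (act a (val x)) (pact_subproof a x).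

(* Convergence in a Grassmannian, which is the quotient of the space of frames
   (matrices of rank q) by the map sending a frame to its column space. *)
Definition grass_cvg (U : nat -> {vspace 'cV[R]_n}) (V : {vspace 'cV[R]_n}) :=
  exists (q : nat) (E : nat -> 'M[R]_(n, q)) (E0 : 'M[R]_(n, q)),
    [/\ \rank E0 = q, vimage E0 fullv = V,
        \forall s \near \oo, vimage (E s) fullv = U s & E @ \oo --> E0].

Definition volume (s : seq 'cV[R]_n) : R :=
  \det (\matrix_(i < n, j < n) (s`_j) i 0).

Definition is_flag (F : nat -> {vspace 'cV[R]_n}) : Prop :=
  (forall k, (k <= n)%N -> \dim (F k) = k) /\
  (forall k, (k < n)%N -> (F k <= F k.+1)%VS).

End Subspaces.

(* The boundary circle of the hyperbolic plane, i.e. the projective line. *)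
Notation circle R := (pspace R 2).

Section Circle.
Variable R : realType.

(* With x = [s : 1] for s in R, this is the orientation given by increasing s,
   i.e. that of the boundary of the upper half plane. The sign does not depend
   on the vectors a, b, c spanning the three lines. *)
Definition positive_triple (x y z : circle R) : Prop :=
  exists a b c : 'cV[R]_2,
    [/\ val x = <[a]>%VS, val y = <[b]>%VS, val z = <[c]>%VS &
        0 < volume [:: a; b] * volume [:: b; c] * volume [:: c; a]].

Definition cyclically_ordered m (x : m.-tuple (circle R)) : Prop :=
  forall i j k : 'I_m, (i < j)%N -> (j < k)%N ->
    positive_triple (tnth x i) (tnth x j) (tnth x k).

(* xm and xp are the repelling and the attracting fixed point of a. *)
Definition fixed_points (a : psl R 2) (xm xp : circle R) : Prop :=
  [/\ xm <> xp, pact a xm = xm, pact a xp = xp,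
      forall x, x <> xm -> grass_cvg (fun k => val (pact (a ^+ k)%g x)) (val xp)
    & forall x, x <> xp -> grass_cvg (fun k => val (pact (a ^- k)%g x)) (val xm)].

End Circle.

Section Fuchsian.
Variable R : realType.

(* The determinant is a Lorentzian form on symmetric 2 x 2 matrices, one sheet
   of the hyperboloid \det S = 1 is the hyperbolic plane, PSL(2,R) acts on it
   by S |-> M S M^T, and the isotropic ray of a *m a^T is the boundary point
   <[a]>. The convex hull of a set of boundary points is the intersection of
   the hyperboloid with the convex cone that they span. *)
Definition hyperbolic_plane : set 'M[R]_2 :=
  [set S | [/\ S^T = S, \det S = 1 & 0 < \tr S]].

Definition hact (a : psl R 2) (S : 'M[R]_2) : 'M[R]_2 :=
  slval (slrep a) *m S *m (slval (slrep a))^T.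

Definition convex_hull (A : set (circle R)) : set 'M[R]_2 :=
  [set S | hyperbolic_plane S /\
     exists (m : nat) (a : 'I_m -> 'cV[R]_2),
       (forall i, exists2 x, A x & a i \in val x) /\
       S = \sum_i a i *m (a i)^T].

Variables (G : groupType) (f : {multiplicative G -> psl R 2}).

(* The accumulation points at infinity of the orbit of the point 1%:M. *)
Definition limit_set : set (circle R) :=
  [set x | exists (a : 'cV[R]_2) (g : nat -> G) (c : nat -> R),
     val x = <[a]>%VS /\
     (fun k => c k *: hact (f (g k)) 1%:M) @ \oo --> a *m a^T].

Definition discrete_image : Prop :=
  \forall a \near (1%g : psl R 2), range f a -> a = 1%g.

Definition convex_cocompact : Prop :=
  exists K : set 'M[R]_2,
    [/\ compact K, K `<=` hyperbolic_plane &
        forall S, convex_hull limit_set S -> exists g, K (hact (f g) S)].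

Definition fuchsian : Prop :=
  [/\ injective f, discrete_image & convex_cocompact].

End Fuchsian.

Section Hitchin.
Variables (R : realType) (n : nat).

Definition purely_loxodromic (a : psl R n) : Prop :=
  exists l : 'I_n -> R,
    injective l /\ char_poly (slval (slrep a)) = \prod_i ('X - (l i)%:P).

(* There is exactly one such homomorphism up to conjugation by GL(n,R), the
   (n-1)-st symmetric power of the standard one. *)
Definition irreducible_hom (t : {multiplicative psl R 2 -> psl R n}) : Prop :=
  continuous t /\
  forall U : {vspace 'cV[R]_n}, (forall a, act (t a) U = U) ->
    U = 0%VS \/ U = fullv.

Variable G : groupType.

Definition n_fuchsian (r : G -> psl R n) : Prop :=
  exists (f : {multiplicative G -> psl R 2})
         (t : {multiplicative psl R 2 -> psl R n}),
    [/\ fuchsian f, irreducible_hom t & forall g, r g = t (f g)].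

(* For a surface with boundary, A consists of the classes of the boundary
   components; for a closed surface A is empty. *)
Definition hitchin (A : set G) (r : G -> psl R n) : Prop :=
  exists p : R -> {multiplicative G -> psl R n},
    [/\ forall g, p 0 g = r g,
        n_fuchsian (p 1),
        forall g, {within `[0, 1], continuous (fun s => p s g)}
      & forall s g, 0 <= s <= 1 -> A g -> purely_loxodromic (p s g)].

End Hitchin.

(* G is the group presented by generators alpha, beta, gamma and the relation
   alpha * gamma * beta = 1. *)
Definition pants_group (G : groupType) (alpha beta gamma : G) : Prop :=
  (alpha * gamma * beta = 1)%g /\
  forall (H : groupType) (a b c : H), (a * c * b = 1)%g ->
    exists f : {multiplicative G -> H},
      [/\ f alpha = a, f beta = b, f gamma = c &
          forall f' : {multiplicative G -> H},
            f' alpha = a -> f' beta = b -> f' gamma = c -> f' =1 f].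

Section Pants.
Variables (R : realType) (G : groupType) (j : {multiplicative G -> psl R 2}).

(* j is the holonomy of a hyperbolic metric with totally geodesic boundary on
   the pair of pants; xm and xp stand for the repelling and attracting fixed
   points of x. *)
Definition pants_holonomy (alpha beta gamma : G)
    (am ap bm bp cm cp : circle R) : Prop :=
  [/\ fuchsian j, fixed_points (j alpha) am ap, fixed_points (j beta) bm bp,
      fixed_points (j gamma) cm cp &
      cyclically_ordered [tuple am; ap; bm; bp; cm; cp]].

(* S is a reflection of the hyperbolic plane across the geodesic from x to y. *)
Definition reflection (x y : circle R) (S : 'M[R]_2) : Prop :=
  exists a b : 'cV[R]_2,
    [/\ val x = <[a]>%VS, val y = <[b]>%VS, S *m a = a & S *m b = - b].

(* The developed image of the mirror orbifold: the group generated by j(G) and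
   the reflections across the geodesics with endpoints in E. *)
Inductive mirror_group (E : set (circle R * circle R)) : 'M[R]_2 -> Prop :=
| mirror_hol g : mirror_group E (slval (slrep (j g)))
| mirror_refl x y S : E (x, y) -> reflection x y S -> mirror_group E S
| mirror_mul S T :
    mirror_group E S -> mirror_group E T -> mirror_group E (S *m T).

(* The double is the orientation double cover of the mirror orbifold, so that
   the holonomy of the doubled metric is the orientation preserving subgroup. *)
Definition double_group (E : set (circle R * circle R)) : set (psl R 2) :=
  [set a | exists2 x : sl R 2, a = slclass x & mirror_group E (slval x)].

End Pants.

Section Frenet.
Variables (R : realType) (n : nat).

(* xi x k is the k-dimensional osculating space at x; the curve with values in
   the projective space is xi^1. *)
Definition frenet (xi : circle R -> nat -> {vspace 'cV[R]_n}) : Prop :=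
  [/\ forall x, is_flag (xi x),
      forall m (x : 'I_m -> circle R) (k : 'I_m -> nat),
        injective x -> (forall i, (0 < k i)%N) -> (\sum_i k i <= n)%N ->
        directv (\sum_i xi (x i) (k i))%VS
    & forall m (y : nat -> 'I_m -> circle R) (k : 'I_m -> nat) (x : circle R),
        (forall s, injective (y s)) -> (forall i, (0 < k i)%N) ->
        (\sum_i k i <= n)%N ->
        (forall i, grass_cvg (fun s => val (y s i)) (val x)) ->
        grass_cvg (fun s => (\sum_i xi (y s i) (k i))%VS)
                  (xi x (\sum_i k i)%N)].

(* xi is equivariant under a Hitchin representation r' of the fundamental group
   G' of the double, r' extending r. It is defined on the whole boundary circle
   of G'; the boundary at infinity of G is the limit set of j in this circle,
   and on it xi does not depend on the extension. *)
Definition associated_frenet (G : groupType) (j : {multiplicative G -> psl R 2})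
    (E : set (circle R * circle R)) (r : G -> psl R n)
    (xi : circle R -> nat -> {vspace 'cV[R]_n}) : Prop :=
  frenet xi /\
  exists (G' : groupType) (i : {multiplicative G -> G'})
         (j' : {multiplicative G' -> psl R 2})
         (r' : {multiplicative G' -> psl R n}),
    [/\ injective j' /\ range j' = double_group j E,
        forall g, j' (i g) = j g,
        forall g, r' (i g) = r g,
        hitchin set0 r'
      & forall g x k, (k <= n)%N -> xi (pact (j' g) x) k = act (r' g) (xi x k)].

End Frenet.

Section CrossRatio.
Variables (R : realType) (n : nat) (T : Type).

Definition is_cross_ratio (xi : T -> nat -> {vspace 'cV[R]_n})
    (B : T -> T -> T -> T -> R) : Prop :=
  exists (h : T -> 'rV[R]_n) (v : T -> 'cV[R]_n),
    let pair x y := (h x *m v y) 0 0 in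
    [/\ forall x, v x != 0 /\ v x \in xi x 1%N,
        forall x, h x != 0 /\ (forall w, (w \in xi x n.-1) = (h x *m w == 0))
      & forall x y z t,
          B x y z t = (pair x y * pair z t) / (pair z y * pair x t)].

End CrossRatio.

Section PeriodGap.
Variables (R : realType) (B : circle R -> circle R -> circle R -> circle R -> R).

(* am and ap are the fixed points of a, and y is any other point. *)
Definition period (a : psl R 2) (am ap y : circle R) : R :=
  ln `|B am (pact a y) ap y|.

Definition pant_gap (am ap bp cm : circle R) : R := ln (B ap cm am bp).

End PeriodGap.

Section EdgeFunctions.
Variables (R : realType) (n : nat).
Implicit Types X Y Z T : nat -> {vspace 'cV[R]_n}.

(* The eigenvalues have multiplicity one; that their absolute values are
   distinct, which makes L unique, is not part of the definition. *)
Definition ordered_eigenlines (a : psl R n) (L : 'I_n -> {vspace 'cV[R]_n}) :=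
  exists (l : 'I_n -> R) (e : 'I_n -> 'cV[R]_n),
    [/\ injective l,
        forall i, e i != 0 /\ L i = <[e i]>%VS,
        forall i, slval (slrep a) *m e i = l i *: e i
      & forall i k : 'I_n, (i <= k)%N -> `|l k| <= `|l i|].

(* The permutations are those of {0, .., n-1}. *)
Definition weyl_flag (L : 'I_n -> {vspace 'cV[R]_n}) (u : 'S_n) (k : nat) :
  {vspace 'cV[R]_n} := (\sum_(i < n | (i < k)%N) L (u i))%VS.

Definition flag_act (a : psl R n) X (k : nat) : {vspace 'cV[R]_n} := act a (X k).

Definition adapted X (x : seq 'cV[R]_n) : Prop :=
  [/\ size x = n, free x & forall k, (k <= n)%N -> X k = <<take k x>>%VS].

(* The volume form is the determinant; any other choice yields the same value,
   as does any other choice of the adapted bases. *)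
Definition edge_function (i : nat) X Y Z T (d : R) : Prop :=
  exists x y z t : seq 'cV[R]_n,
    [/\ adapted X x, adapted Y y, adapted Z z, adapted T t &
        d = (volume (take i x ++ take (n - i - 1) z ++ take 1 t) *
             volume (take i.-1 x ++ take 1 y ++ take (n - i) z)) /
            (volume (take i x ++ take 1 y ++ take (n - i - 1) z) *
             volume (take i.-1 x ++ take (n - i) z ++ take 1 t))].

End EdgeFunctions.

(* Main.v *)
(* Let x and z be the attracting and repelling fixed points of alpha. The lines
   <e_i> = xi^(i+1)(x) cap xi^(N-i)(z), where N is the dimension and i counts
   from 0, form an eigenbasis of rho(alpha). In this basis let v(y) span xi^1(y).
   By the Frenet property at the four points x, z, y, t, each ratio
   v_(i+1)(y) / v_i(y) is injective on an arc from x to z; it is continuous,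
   without zeros, tends to 0 at x, and alpha multiplies it by
   lambda_(i+1) / lambda_i. Hence this factor lies between 0 and 1, the absolute
   values of all these ratios are monotone in the same direction, and so their
   product f(y) = v_(N-1)(y) / v_0(y) is still injective on the arc.
   All the quantities in the theorem are determined modulo the span of
   e_1, ..., e_(N-2), i.e. by f: with th = lambda_(N-1) / lambda_0,
   p = f(b+), q = f(c-), one gets exp(l) = 1/th, B = q/p,
   C1 = - th (q - p) / (th q - p) and Bn1 = (th q - p) / (p - q). Here p <> q and
   p <> th q because b+, c- and alpha c- lie on the same arc and b+ differs from
   both c- and alpha c-. *)
Require Import Defs.
From HB Require Import structures.
From mathcomp Require Import all_boot all_order all_algebra perm.
From mathcomp Require Import all_classical all_reals all_analysis.
From mathcomp Require Import ring lra zify.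

Set Implicit Arguments.
Unset Strict Implicit.
Unset Printing Implicit Defensive.

Import Order.TTheory GRing.Theory Num.Theory.
Import numFieldNormedType.Exports.

Local Open Scope classical_set_scope.
Local Open Scope ring_scope.

(** * Multilinear algebra of the determinant of a sequence of columns *)

Section Volume.
Variables (R : realType) (n : nat).
Implicit Types (s : seq 'cV[R]_n) (a b : 'cV[R]_n).

Lemma volume_linear s1 s2 c a b : (size s1 < n)%N ->
  volume (s1 ++ (c *: a + b) :: s2) =
  c * volume (s1 ++ a :: s2) + volume (s1 ++ b :: s2).
Proof.
move=> hs; rewrite -[X in _ = _ + X]mul1r /volume.
(* [determinant_multilinear] speaks of rows, whereas the vectors are columns. *)
rewrite -det_tr -[in X in _ = X + _]det_tr -[in X in _ = _ + X]det_tr.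
apply: (@determinant_multilinear _ _ _ _ _ (Ordinal hs)).
- by apply/rowP => k; rewrite !mxE /= !nth_cat ltnn subnn /= !mxE mul1r.
- apply/matrixP => i k; rewrite !mxE /= !nth_cat; case: ltnP => // h.
  by case E: (_ - _)%N => //; have := neq_bump (size s1) i; lia.
- apply/matrixP => i k; rewrite !mxE /= !nth_cat; case: ltnP => // h.
  by case E: (_ - _)%N => //; have := neq_bump (size s1) i; lia.
Qed.

Lemma volume_add s1 s2 a b : (size s1 < n)%N ->
  volume (s1 ++ (a + b) :: s2) =
  volume (s1 ++ a :: s2) + volume (s1 ++ b :: s2).
Proof. by move=> hs; rewrite -[a in LHS]scale1r volume_linear // mul1r. Qed.

Lemma volume_col0 s1 s2 : (size s1 < n)%N -> volume (s1 ++ 0 :: s2) = 0.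
Proof.
move=> hs; have := volume_linear s2 1 0 0 hs.
by rewrite scaler0 addr0 mul1r -[LHS]addr0 => /addrI.
Qed.

Lemma volume_scale s1 s2 c a : (size s1 < n)%N ->
  volume (s1 ++ (c *: a) :: s2) = c * volume (s1 ++ a :: s2).
Proof. by move=> hs; rewrite -[c *: a]addr0 volume_linear // volume_col0 // addr0. Qed.

Lemma volume_sum s1 s2 (I : Type) (r : seq I) (P : pred I) (F : I -> 'cV[R]_n) :
  (size s1 < n)%N ->
  volume (s1 ++ (\sum_(i <- r | P i) F i) :: s2) =
  \sum_(i <- r | P i) volume (s1 ++ F i :: s2).
Proof.
move=> hs; apply: (big_morph (fun a => volume (s1 ++ a :: s2))).
  by move=> a b; rewrite volume_add.
exact: volume_col0.
Qed.

Lemma volume_alternate s i k : (i < k)%N -> (k < n)%N -> s`_i = s`_k ->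
  volume s = 0.
Proof.
move=> ik kn e; rewrite /volume -det_tr.
apply: (@determinant_alternate _ _ _ (Ordinal (ltn_trans ik kn)) (Ordinal kn)).
  by rewrite -val_eqE /= ltn_eqF.
by move=> l; rewrite !mxE /= e.
Qed.

(** Polarization: the volume with [a + b] in both neighbouring places vanishes, and so do two of the
    four terms of its expansion. *)
Lemma volume_swap s1 s2 a b : ((size s1).+1 < n)%N ->
  volume (s1 ++ a :: b :: s2) = - volume (s1 ++ b :: a :: s2).
Proof.
move=> hs; have hs' : (size s1 < n)%N by apply: ltnW.
have alt c : volume (s1 ++ c :: c :: s2) = 0.
  apply: (@volume_alternate _ (size s1) (size s1).+1) => //.
  by rewrite !nth_cat ltnn ltnNge leqnSn /= subnn subSnn.
have addr' c a' b' : volume (s1 ++ c :: (a' + b') :: s2) =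
    volume (s1 ++ c :: a' :: s2) + volume (s1 ++ c :: b' :: s2).
  by rewrite -!(cat_rcons c) volume_add // size_rcons.
have := alt (a + b); rewrite volume_add // !addr' !alt add0r addr0.
by move/eqP; rewrite addr_eq0 => /eqP.
Qed.

Lemma volume_move s1 s s2 a : (size s1 + size s < n)%N ->
  volume (s1 ++ a :: s ++ s2) = (-1) ^+ size s * volume (s1 ++ s ++ a :: s2).
Proof.
elim: s s1 => [|b s IH] s1 /=; first by rewrite expr0 mul1r.
rewrite addnS => hs; rewrite volume_swap; last by apply: leq_trans hs; rewrite ltnS ltnS leq_addr.
rewrite -cat_rcons IH ?size_rcons ?addSn // cat_rcons exprS mulN1r mulNr.
by [].
Qed.

(** Expanding [a] in [s2] repeats a column in every term. The size bounds keep both copies among the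
    first [n] entries, the only ones that [volume] reads. *)
Lemma volume_in_span s1 s2 s3 a : (size s1 < n)%N -> (size s1 + (size s2).+1 <= n)%N ->
  a \in span s2 -> volume (s1 ++ a :: s2 ++ s3) = 0.
Proof.
move=> hs hs2 /(coord_span (X := in_tuple s2)) ->.
rewrite volume_sum // big1 // => k _; rewrite volume_scale //.
rewrite (@volume_alternate _ (size s1) (size s1 + k.+1)) ?mulr0 //.
- by rewrite -addSnnS leq_addr.
- by apply: leq_trans hs2; rewrite ltn_add2l ltnS.
- rewrite !nth_cat ltnn subnn /= ltnNge leq_addr /= addnC addnK /=.
  by rewrite nth_cat ltn_ord.
Qed.

Lemma volume_mulmx (M : 'M[R]_n) s : (n <= size s)%N ->
  volume (map (mulmx M) s) = \det M * volume s.
Proof.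
move=> hs; rewrite /volume -det_mulmx; congr (\det _).
apply/matrixP => i k; rewrite !mxE (nth_map 0) ?(leq_trans (ltn_ord k)) // mxE.
by apply: eq_bigr => l _; rewrite !mxE.
Qed.

(** A left kernel vector of the transposed matrix would be the coefficients of a linear relation in
    [s]. *)
Lemma volume_free s : size s = n -> free s -> volume s != 0.
Proof.
move=> hs fs; apply/negP; rewrite /volume -det_tr => /det0P[c c0 hc].
have ss : size s == n by apply/eqP.
have sum0 : \sum_i c 0 i *: s`_i = 0.
  apply/colP => i; have /rowP/(_ i) := hc; rewrite !mxE summxE => h.
  by rewrite -[RHS]h; apply: eq_bigr => k _; rewrite !mxE.
have /freeP/(_ _ sum0) ck := (fs : free (Tuple ss)).
by move/eqP: c0; apply; apply/rowP => i; rewrite mxE ck.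
Qed.

End Volume.

(** * Coordinates with respect to a frame *)

Section Frame.
Variables (R : realType) (n : nat) (e : 'I_n -> 'cV[R]_n).

Definition frame_mx : 'M[R]_n := \matrix_(i, k) e k i 0.

(** Once the frame is a basis these forms are its dual basis. Row vectors are the shape in which
    [grass_cvg_ratio] takes linear forms. *)
Definition frame_row (i : 'I_n) : 'rV[R]_n := row i (invmx frame_mx).

Definition frame_coord (i : 'I_n) (a : 'cV[R]_n) : R := (frame_row i *m a) 0 0.

Lemma frame_mx_mul (c : 'cV[R]_n) : frame_mx *m c = \sum_i c i 0 *: e i.
Proof.
apply/colP => i; rewrite !mxE summxE.
by apply: eq_bigr => k _; rewrite !mxE mulrC.
Qed.

Lemma frame_coordE i a : frame_coord i a = (invmx frame_mx *m a) i 0.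
Proof. by rewrite /frame_coord -row_mul mxE. Qed.

Lemma frame_coordD i a b : frame_coord i (a + b) = frame_coord i a + frame_coord i b.
Proof. by rewrite /frame_coord mulmxDr mxE. Qed.

Lemma frame_coordZ i c a : frame_coord i (c *: a) = c * frame_coord i a.
Proof. by rewrite /frame_coord -scalemxAr mxE. Qed.

Lemma frame_coord0 i : frame_coord i 0 = 0.
Proof. by rewrite /frame_coord mulmx0 mxE. Qed.

Lemma frame_unit :
  (forall c : 'I_n -> R, \sum_i c i *: e i = 0 -> forall i, c i = 0) ->
  frame_mx \in unitmx.
Proof.
move=> indep; rewrite unitmxE unitfE -det_tr; apply/negP => /det0P[c c0 hc].
move/eqP: c0; apply; apply/rowP => i; rewrite mxE; apply: indep i.
rewrite -[LHS](_ : frame_mx *m c^T = _); first by rewrite -[LHS]trmxK trmx_mul trmxK hc trmx0.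
by rewrite frame_mx_mul; apply: eq_bigr => i _; rewrite mxE.
Qed.

Hypothesis unit_e : frame_mx \in unitmx.

Lemma frame_coord_sum (c : 'I_n -> R) i : frame_coord i (\sum_k c k *: e k) = c i.
Proof.
rewrite (_ : \sum_k _ = frame_mx *m (\col_k c k)).
  by rewrite frame_coordE mulKmx // mxE.
by rewrite frame_mx_mul; apply: eq_bigr => k _; rewrite mxE.
Qed.

Lemma frame_coord_partial_sum (P : pred 'I_n) (c : 'I_n -> R) i :
  frame_coord i (\sum_(k | P k) c k *: e k) = if P i then c i else 0.
Proof.
rewrite big_mkcond -(frame_coord_sum (fun k => if P k then c k else 0)).
by congr frame_coord; apply: eq_bigr => k _; case: ifP; rewrite ?scale0r.
Qed.

Lemma frame_decomp a : a = \sum_i frame_coord i a *: e i.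
Proof.
rewrite -{1}[a](mulKVmx unit_e) frame_mx_mul.
by apply: eq_bigr => i _; rewrite frame_coordE.
Qed.

Lemma frame_coord_basis i k : frame_coord i (e k) = (i == k)%:R.
Proof.
rewrite -(frame_coord_sum (fun i => (i == k)%:R)); congr frame_coord.
rewrite (bigD1 k) //= eqxx scale1r big1 ?addr0 // => l /negPf ->.
by rewrite scale0r.
Qed.

Lemma frame_coord_eq0 a : (forall i, frame_coord i a = 0) -> a = 0.
Proof.
move=> h; rewrite [a]frame_decomp big1 // => i _; by rewrite h scale0r.
Qed.

End Frame.

(** * Bases adapted to a flag *)

Section Flags.
Variables (R : realType) (n : nat) (F : nat -> {vspace 'cV[R]_n}).
Hypothesis flagF : is_flag F.

Lemma flag_mono k l : (k <= l)%N -> (l <= n)%N -> (F k <= F l)%VS.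
Proof.
elim: l => [|l IH]; first by rewrite leqn0 => /eqP ->.
rewrite leq_eqVlt => /orP[/eqP -> //|]; rewrite ltnS => kl ln.
by apply: subv_trans (IH kl (ltnW ln)) (flagF.2 _ ln).
Qed.

(** Downward induction on [i], with [d] bounding [n - i]: if all later coefficients vanish but [c i]
    does not, solving for [e i] puts it into [F i]. The case [k = 0] is linear independence. *)
Lemma flag_triangular (e : 'I_n -> 'cV[R]_n) (c : 'I_n -> R) (k : nat) :
  (forall i : 'I_n, e i \in F i.+1) -> (forall i : 'I_n, e i \notin F i) ->
  \sum_i c i *: e i \in F k -> forall i : 'I_n, (k <= i)%N -> c i = 0.
Proof.
move=> ein enot ck.
suff H d (i : 'I_n) : (n - i <= d)%N -> (k <= i)%N -> c i = 0.
  by move=> i; apply: (H n); rewrite leq_subr.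
elim: d i => [|d IH] i hi ki; first by have := ltn_ord i; lia.
have tail (l : 'I_n) : (i < l)%N -> c l = 0 by move=> il; apply: IH; lia.
apply/eqP; apply: contraNT (enot i) => ci0.
rewrite -[e i](scalerK ci0) memvZ //.
move: ck => /(subvP (flag_mono ki (ltnW (ltn_ord i)))).
rewrite (bigD1 i) //= addrC rpredDl //.
apply: rpred_sum => l li; case: (ltngtP l i) => h; last first.
- by move: li; rewrite -val_eqE /= h eqxx.
- by rewrite tail // scale0r mem0v.
- by apply: memvZ; apply: (subvP (flag_mono h (ltnW (ltn_ord i)))).
Qed.

End Flags.

(** * The action of PSL(n,R) on subspaces and lines *)

Section ProjectiveAction.
Variables (R : realType) (n : nat).
Implicit Types (a b : psl R n) (U : {vspace 'cV[R]_n}).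

Lemma vimageP m (M : 'M[R]_(n, m)) (U : {vspace 'cV[R]_m}) v :
  reflect (exists2 w, w \in U & v = M *m w) (v \in vimage M U).
Proof.
apply: (iffP memv_imgP) => -[w wU ->]; exists w; rewrite ?lfunE //.
Qed.

(** Chosen representatives multiply only up to sign. A nonzero scalar is all that matters, since
    subspaces do not see it. *)
Lemma slrepM a b : exists2 c : R, c != 0 &
  slval (slrep (a * b)%g) = c *: (slval (slrep a) *m slval (slrep b)).
Proof.
have /slclassP/orP[/eqP h|/eqP h] : slclass (slrep (a * b)%g) = slclass (slrep a * slrep b)%g.
- by rewrite slrepK.
- by exists 1; rewrite ?oner_neq0 // scale1r h.
- by exists (-1); rewrite ?oppr_eq0 ?oner_neq0 // scaleN1r h.
Qed.

Lemma slrep1 : exists2 c : R, c != 0 & slval (slrep (1%g : psl R n)) = c%:M.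
Proof.
have /slclassP/orP[/eqP h|/eqP h] : slclass (slrep (1%g : psl R n)) = slclass 1%g.
- by rewrite slrepK.
- by exists 1; rewrite ?oner_neq0 // h.
- by exists (-1); rewrite ?oppr_eq0 ?oner_neq0 // h /= raddfN.
Qed.

Lemma act_mul a b U : act (a * b)%g U = act a (act b U).
Proof.
have [c c0 h] := slrepM a b; apply/vspaceP => v; apply/vimageP/vimageP.
- move=> [w wU ->]; exists (c *: (slval (slrep b) *m w)).
    by apply: memvZ; apply/vimageP; exists w.
  by rewrite h -scalemxAl -scalemxAr mulmxA.
- move=> [_ /vimageP[w wU ->] ->]; exists (c^-1 *: w); first exact: memvZ.
  by rewrite h -scalemxAl -scalemxAr scalerA divff // scale1r mulmxA.
Qed.

Lemma act1 U : act 1%g U = U.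
Proof.
have [c c0 h] := slrep1; apply/vspaceP => v; apply/vimageP/idP.
- by move=> [w wU ->]; rewrite h mul_scalar_mx memvZ.
- move=> vU; exists (c^-1 *: v); first exact: memvZ.
  by rewrite h mul_scalar_mx scalerA divff // scale1r.
Qed.

Lemma pact_mul a b (x : pspace R n) : pact (a * b)%g x = pact a (pact b x).
Proof. by apply: val_inj; rewrite /= act_mul. Qed.

Lemma pact1 (x : pspace R n) : pact 1%g x = x.
Proof. by apply: val_inj; rewrite /= act1. Qed.

Lemma pactK a : cancel (pact a) (pact a^-1%g : pspace R n -> pspace R n).
Proof. by move=> x; rewrite -pact_mul mulVg pact1. Qed.

Lemma pspace_line (x : pspace R n) : exists2 a, a != 0 & val x = <[a]>%VS.
Proof.
exists (vpick (val x)).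
  by rewrite vpick0 -dimv_eq0 (eqP (valP x)).
apply/eqP; rewrite eq_sym eqEdim -memvE memv_pick dim_vline vpick0 -dimv_eq0.
by rewrite (eqP (valP x)).
Qed.

End ProjectiveAction.

(** * Limits in Grassmannians, tested by linear forms *)

Section Grassmannian.
Variables (R : realType) (n : nat).

Lemma cvg_row_mul q (E : nat -> 'M[R]_(n, q)) E0 (phi : 'rV[R]_n) i :
  E @ \oo --> E0 -> (fun s => (phi *m E s) 0 i) @ \oo --> (phi *m E0) 0 i.
Proof.
move=> hE; rewrite mxE.
rewrite (_ : (fun s => _) = (fun s => \sum_k phi 0 k * E s k i)); last first.
  by apply/funext => s; rewrite mxE.
apply: cvg_big; first exact: add_continuous.
move=> k _; apply: cvgMr.
exact: (cvg_comp _ _ hE (@coord_continuous _ _ _ _ _ _)).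
Qed.

(** Evaluated on one column of the converging frames, both forms become convergent sequences of
    scalars, and [g] is eventually their quotient. The column is chosen so that the denominator has
    a nonzero limit. *)
Lemma grass_cvg_ratio (U : nat -> {vspace 'cV[R]_n}) V (phi psi : 'rV[R]_n)
    (g : nat -> R) (g0 : R) :
  grass_cvg U V ->
  (forall s w, w \in U s -> phi *m w = g s *: (psi *m w)) ->
  (forall w, w \in V -> phi *m w = g0 *: (psi *m w)) ->
  (exists2 w, w \in V & psi *m w != 0) ->
  g @ \oo --> g0.
Proof.
move=> [q [E [E0 [_ EV EU hE]]]] hU hV [w wV w0].
move: wV; rewrite -EV => /vimageP[c _ wE].
(* If [psi] killed every column of the limit frame, it would vanish on [V]. *)
have [i i0] : exists i, (psi *m E0) 0 i != 0.
  apply/existsP; apply: contraNT w0 => /existsPn h; rewrite wE mulmxA.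
  apply/eqP/matrixP => k l; rewrite !mxE big1 // => i _.
  by rewrite ord1 (eqP (negPn (h i))) mul0r.
pose d : 'cV[R]_q := delta_mx i 0.
have ev (F : 'M[R]_(n, q)) (f : 'rV[R]_n) : (f *m (F *m d)) 0 0 = (f *m F) 0 i.
  by rewrite mulmxA -colE mxE.
have -> : g0 = (phi *m E0) 0 i / (psi *m E0) 0 i.
  have := hV (E0 *m d); rewrite -EV => /(_ _)/matrixP/(_ 0 0).
  rewrite [X in _ = X]mxE !ev => ->; first by rewrite mulfK.
  by apply/vimageP; exists d; rewrite ?memvf.
have cpsi := cvg_row_mul (phi := psi) (i := i) hE.
have : (fun s => (phi *m E s) 0 i / (psi *m E s) 0 i) @ \oo -->
    (phi *m E0) 0 i / (psi *m E0) 0 i.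
  by apply: cvgM; [exact: cvg_row_mul | exact: cvgV].
apply: cvg_trans; apply: near_eq_cvg.
have /cvgr_neq0 := cpsi; move/(_ i0) => nz.
near=> s.
have Es0 : (psi *m E s) 0 i != 0 by near: s.
have EsU : vimage (E s) fullv = U s by near: s.
have := hU s (E s *m d); rewrite -EsU => /(_ _)/matrixP/(_ 0 0).
rewrite [X in _ = X]mxE !ev => ->; first by rewrite mulfK.
by apply/vimageP; exists d; rewrite ?memvf.
Unshelve. all: by end_near.
Qed.

Lemma vimage_vline (a : 'cV[R]_n) : vimage a fullv = <[a]>%VS.
Proof.
apply/vspaceP => v; apply/vimageP/vlineP => [[w _ ->]|[b ->]].
  by exists (w 0 0); rewrite {1}[w]mx11_scalar mul_mx_scalar.
by exists b%:M; rewrite ?memvf // mul_mx_scalar.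
Qed.

Lemma grass_cvg_vline (a : nat -> 'cV[R]_n) (a0 : 'cV[R]_n) :
  a0 != 0 -> a @ \oo --> a0 -> grass_cvg (fun s => <[a s]>%VS) <[a0]>%VS.
Proof.
move=> a0n cvga; exists 1%N, a, a0; split => //; last 2 first.
- by rewrite vimage_vline.
- by apply: nearW => s; rewrite vimage_vline.
suff a0T : a0^T != 0 by rewrite -mxrank_tr rank_rV a0T.
by apply: contra a0n => /eqP h; rewrite -[a0]trmxK h trmx0.
Qed.

End Grassmannian.

(** * Linear independence along a Frenet curve *)

Section FrenetIndependence.
Variables (R : realType) (n : nat) (xi : circle R -> nat -> {vspace 'cV[R]_n}).
Hypothesis frenet_xi : frenet xi.

Lemma frenet_flag x : is_flag (xi x).
Proof. by case: frenet_xi. Qed.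

(* Unlike in the definition of a Frenet curve, the multiplicities may vanish. *)
Lemma frenet_independent m (x : 'I_m -> circle R) (k : 'I_m -> nat)
    (us : 'I_m -> 'cV[R]_n) :
  injective x -> (\sum_i k i <= n)%N -> (forall i, us i \in xi (x i) (k i)) ->
  \sum_i us i = 0 -> forall i, us i = 0.
Proof.
move=> injx kn usin us0.
have us0k i : k i = 0%N -> us i = 0.
  move=> ki; move: (usin i); rewrite ki.
  have -> : xi (x i) 0 = 0%VS.
    by apply/eqP; rewrite -dimv_eq0 (frenet_flag (x i)).1.
  by rewrite memv0 => /eqP.
(* The Frenet axiom asks for positive multiplicities, so it is applied to the indices in [A],
   renumbered by [enum_val]; the other vectors are zero. *)
pose A := [pred i | (0 < k i)%N].
have sumA (V : zmodType) (F : 'I_m -> V) : (forall i, ~~ A i -> F i = 0) ->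
    \sum_i F i = \sum_(l < #|A|) F (enum_val l).
  move=> F0; rewrite (bigID A) /= [X in _ + X]big1 ?addr0; last by move=> i /F0.
  exact: big_enum_val.
have kA : (\sum_(l < #|A|) k (enum_val l) <= n)%N.
  apply: leq_trans kn; rewrite -(big_enum_val k) /= [leqRHS](bigID A) /=.
  exact: leq_addr.
have injA : injective (fun l : 'I_#|A| => x (enum_val l)).
  by move=> l l' /injx /enum_val_inj.
case: frenet_xi => _ /(_ _ _ (fun l : 'I_#|A| => k (enum_val l)) injA) dir _.
have {}dir := dir (fun l => enum_valP l) kA.
have := directv_sum_independent dir (fun l => us (enum_val l)).
move=> H i; have [ki|ki] := posnP (k i); first exact: us0k.
have iA : i \in A by rewrite inE.
rewrite -(enum_rankK_in iA iA); apply: (H _ _ (enum_rank_in iA i)) => //.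
rewrite -sumA // => l; rewrite /A /= -eqn0Ngt => /eqP; exact: us0k.
Qed.

(** Two, three and four points are the cases that occur. The conclusion is about the last summand,
    the vector to be killed in each application. *)
Lemma frenet2 x y k l u v : x <> y -> (k + l <= n)%N ->
  u \in xi x k -> v \in xi y l -> u + v = 0 -> v = 0.
Proof.
move=> xy kl ux vy uv.
suff /(_ ord_max) : forall i, tnth [tuple u; v] i = 0 by rewrite (tnth_nth 0).
apply: (@frenet_independent 2 (tnth [tuple x; y]) (tnth [tuple k; l])).
- move=> i i'; rewrite !(tnth_nth x) => H; apply: val_inj; move: i i' H.
  by do 2![case=> [[|[]]] //= _] => // /esym.
- by rewrite !big_ord_recl big_ord0 !(tnth_nth 0%N) /= addn0.
- move=> i; rewrite (tnth_nth x) (tnth_nth 0%N) (tnth_nth 0).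
  by case: i => [[|[]]].
- by rewrite !big_ord_recl big_ord0 !(tnth_nth 0) /= addr0.
Qed.

Lemma frenet3 x y z k l m u v w : x <> y -> x <> z -> y <> z ->
  (k + l + m <= n)%N -> u \in xi x k -> v \in xi y l -> w \in xi z m ->
  u + v + w = 0 -> w = 0.
Proof.
move=> xy xz yz klm ux vy wz uvw.
suff /(_ ord_max) : forall i, tnth [tuple u; v; w] i = 0 by rewrite (tnth_nth 0).
apply: (@frenet_independent 3 (tnth [tuple x; y; z]) (tnth [tuple k; l; m])).
- move=> i i'; rewrite !(tnth_nth x) => H; apply: val_inj; move: i i' H.
  by do 2![case=> [[|[|[]]]] //= _] => // /esym.
- by rewrite !big_ord_recl big_ord0 !(tnth_nth 0%N) /= addn0 addnA.
- move=> i; rewrite (tnth_nth x) (tnth_nth 0%N) (tnth_nth 0).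
  by case: i => [[|[|[]]]].
- by rewrite !big_ord_recl big_ord0 !(tnth_nth 0) /= addr0 addrA.
Qed.

Lemma frenet4 x y z t k l m p u v w a :
  x <> y -> x <> z -> y <> z -> x <> t -> y <> t -> z <> t ->
  (k + l + m + p <= n)%N ->
  u \in xi x k -> v \in xi y l -> w \in xi z m -> a \in xi t p ->
  u + v + w + a = 0 -> a = 0.
Proof.
move=> xy xz yz xt yt zt klm ux vy wz at_ uvw.
suff /(_ ord_max) : forall i, tnth [tuple u; v; w; a] i = 0 by rewrite (tnth_nth 0).
apply: (@frenet_independent 4 (tnth [tuple x; y; z; t]) (tnth [tuple k; l; m; p])).
- move=> i i'; rewrite !(tnth_nth x) => H; apply: val_inj; move: i i' H.
  by do 2![case=> [[|[|[|[]]]]] //= _] => // /esym.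
- by rewrite !big_ord_recl big_ord0 !(tnth_nth 0%N) /= addn0 !addnA.
- move=> i; rewrite (tnth_nth x) (tnth_nth 0%N) (tnth_nth 0).
  by case: i => [[|[|[|[]]]]].
- by rewrite !big_ord_recl big_ord0 !(tnth_nth 0) /= addr0 !addrA.
Qed.

End FrenetIndependence.

(** * The frame defined by two opposite osculating flags *)

Section OsculatingFrame.
Variables (R : realType) (n : nat) (xi : circle R -> nat -> {vspace 'cV[R]_n}).
Hypothesis frenet_xi : frenet xi.

(** Both osculating flags are coordinate flags, from the front at [x] and from the back at [z]. The
    points are arbitrary here; the field names anticipate the attracting and repelling fixed
    points. *)
Record osculating_frame (x z : circle R) (e : 'I_n -> 'cV[R]_n) : Prop :=
  OsculatingFrame {
    osc_unit : frame_mx e \in unitmx;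
    osc_attr : forall k a, (k <= n)%N ->
      a \in xi x k <-> forall i : 'I_n, (k <= i)%N -> frame_coord e i a = 0;
    osc_rep : forall k a, (k <= n)%N ->
      a \in xi z k <-> forall i : 'I_n, (i < n - k)%N -> frame_coord e i a = 0 }.

Lemma osculating_frame_exists x z : x <> z -> exists e, osculating_frame x z e.
Proof.
move=> xz.
have dimxi y k : (k <= n)%N -> \dim (xi y k) = k by case: (frenet_flag frenet_xi y) => + _; apply.
(* The dimensions [i + 1] and [n - i] add up to [n + 1], so the two subspaces meet nontrivially. *)
have ex (i : 'I_n) : exists a, [&& a != 0, a \in xi x i.+1 & a \in xi z (n - i)].
  exists (vpick (xi x i.+1 :&: xi z (n - i))%VS).
  rewrite vpick0 -memv_cap memv_pick andbT -dimv_eq0 -lt0n.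
  have := dimv_sum_cap (xi x i.+1) (xi z (n - i)).
  rewrite !dimxi ?leq_subr //; have := dimvS (subvf (xi x i.+1 + xi z (n - i))).
  rewrite dimvf /dim /= muln1; have := ltn_ord i; lia.
have [e he] := choice ex.
have e0 i : e i != 0 by case/and3P: (he i).
have ex1 i : e i \in xi x i.+1 by case/and3P: (he i).
have ez1 i : e i \in xi z (n - i) by case/and3P: (he i).
have exn (i : 'I_n) : e i \notin xi x i.
  apply: contra (e0 i) => h; apply/eqP.
  apply: (frenet2 frenet_xi xz _ (rpredNr h) (ez1 i)); last by rewrite addNr.
  by have := ltn_ord i; lia.
have ezn (i : 'I_n) : e i \notin xi z (n - i.+1).
  apply: contra (e0 i) => h; apply/eqP.
  apply: (frenet2 frenet_xi xz _ (rpredNr (ex1 i)) h); last by rewrite addNr.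
  by have := ltn_ord i; lia.
have unit_e : frame_mx e \in unitmx.
  apply: frame_unit => c c0 i.
  apply: (flag_triangular (frenet_flag frenet_xi x) ex1 exn (k := 0)) => //.
  by rewrite c0 mem0v.
exists e; split=> // k a kn; split.
- by rewrite {1}(frame_decomp unit_e a) => /(flag_triangular (frenet_flag frenet_xi x) ex1 exn).
- move=> h; rewrite (frame_decomp unit_e a); apply: rpred_sum => i _.
  have [ki|ik] := leqP k i; first by rewrite h // scale0r mem0v.
  by apply: memvZ; apply: (subvP (flag_mono (frenet_flag frenet_xi x) ik kn)).
(* The frame is triangular for the flag at [z] only after its order is reversed. *)
- rewrite {1}(frame_decomp unit_e a) (reindex_inj rev_ord_inj) /=.
  move=> /(flag_triangular (frenet_flag frenet_xi z)) H i ik.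
  rewrite -[i]rev_ordK; apply: H.
  + by move=> l; have := ez1 (rev_ord l); rewrite /= subKn.
  + by move=> l; have := ezn (rev_ord l); rewrite /= subnSK // subKn // ltnW.
  + by rewrite /=; have := ltn_ord i; lia.
- move=> h; rewrite (frame_decomp unit_e a); apply: rpred_sum => i _.
  have [ki|ik] := ltnP i (n - k); first by rewrite h // scale0r mem0v.
  apply: memvZ; apply: (subvP (flag_mono (frenet_flag frenet_xi z) _ kn)) (ez1 i).
  by lia.
Qed.

End OsculatingFrame.

(** * Coordinate ratios along the curve: zeros, injectivity and limits *)

Section CurveRatios.
Variables (R : realType) (n : nat) (xi : circle R -> nat -> {vspace 'cV[R]_n.+1}).
Hypothesis frenet_xi : frenet xi.
Variables (x z : circle R) (e : 'I_n.+1 -> 'cV[R]_n.+1).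
Hypotheses (xz : x <> z) (osc_e : osculating_frame xi x z e).

Let attr := osc_attr osc_e.
Let rep := osc_rep osc_e.

(** Without its [i]-th coordinate, [v] splits into a vector of [xi x i] and one of [xi z (n - i)].
    With the line at [y], the multiplicities add up to the dimension [n + 1], so directness forces
    [v = 0]. *)
Lemma curve_coord_neq0 y v i : y <> x -> y <> z -> v \in xi y 1%N -> v != 0 ->
  frame_coord e i v != 0.
Proof.
move=> /nesym xy /nesym zy vy; apply: contra => /eqP vi; apply/eqP.
have unit_e := osc_unit osc_e.
pose v1 := \sum_(k < n.+1 | (k < i)%N) frame_coord e k v *: e k.
pose v2 := \sum_(k < n.+1 | (i < k)%N) frame_coord e k v *: e k.
have vE : v = v1 + v2.
  rewrite {1}(frame_decomp unit_e v) (bigID (fun k : 'I_n.+1 => (k < i)%N)) /=.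
  congr (_ + _); rewrite (bigD1 i) ?ltnn //= vi scale0r add0r.
  by apply: eq_bigl => k; rewrite -leqNgt ltn_neqAle eq_sym andbC.
have v1x : v1 \in xi x i.
  by apply/attr => [|k ik]; [exact/ltnW/ltn_ord | rewrite frame_coord_partial_sum // ltnNge ?ik ?il].
have v2z : v2 \in xi z (n.+1 - i.+1)%N.
  apply/rep => [|k ik]; [exact: leq_subr | rewrite frame_coord_partial_sum //].
  by case: ltnP => //; have := ltn_ord i; lia.
apply: (frenet3 frenet_xi xz xy zy _ (rpredNr v1x) (rpredNr v2z) vy).
  by have := ltn_ord i; lia.
by rewrite vE addrACA addNr addNr addr0.
Qed.

(** [vpick] only makes a choice: away from [x] and [z] every nonzero vector of the line gives the
    same ratio, by [curve_ratioE]. *)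
Definition curve_ratio (i k : 'I_n.+1) (y : circle R) : R :=
  frame_coord e k (vpick (xi y 1%N)) / frame_coord e i (vpick (xi y 1%N)).

Lemma xi_line y : xi y 1%N = <[vpick (xi y 1%N)]>%VS.
Proof.
have d1 : \dim (xi y 1%N) = 1%N by exact: (frenet_flag frenet_xi y).1.
apply/eqP; rewrite eq_sym eqEdim -memvE memv_pick dim_vline vpick0 -dimv_eq0.
by rewrite d1.
Qed.

Lemma xi_pick_neq0 y : vpick (xi y 1%N) != 0.
Proof.
by rewrite vpick0 -dimv_eq0 (frenet_flag frenet_xi y).1.
Qed.

Lemma pick_coord_neq0 y i : y <> x -> y <> z -> frame_coord e i (vpick (xi y 1%N)) != 0.
Proof.
by move=> yx yz; apply: curve_coord_neq0 yx yz (memv_pick _) (xi_pick_neq0 y).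
Qed.

Lemma curve_ratioE i k y v : y <> x -> y <> z -> v \in xi y 1%N ->
  frame_coord e k v = curve_ratio i k y * frame_coord e i v.
Proof.
move=> yx yz; rewrite xi_line => /vlineP[c ->].
rewrite !frame_coordZ mulrCA /curve_ratio divfK //; exact: pick_coord_neq0.
Qed.

Lemma curve_ratio_neq0 i k y : y <> x -> y <> z -> curve_ratio i k y != 0.
Proof.
by move=> yx yz; rewrite mulf_neq0 ?invr_eq0 //; apply: pick_coord_neq0.
Qed.

(* If two points had the same ratio, the lines of the curve above them would
   be dependent modulo xi^i(x) + xi^(n-i-1)(z). *)
Lemma curve_ratio_inj (i k : 'I_n.+1) y t : k = i.+1 :> nat ->
  y <> x -> y <> z -> t <> x -> t <> z -> curve_ratio i k y = curve_ratio i k t -> y = t.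
Proof.
move=> ki yx yz tx tz eqr; apply: contrapT => yt.
have unit_e := osc_unit osc_e.
set v := vpick (xi y 1%N); set w := vpick (xi t 1%N).
have vy : v \in xi y 1%N by exact: memv_pick.
have wt : w \in xi t 1%N by exact: memv_pick.
have vi : frame_coord e i v != 0 by exact: pick_coord_neq0.
have wi : frame_coord e i w != 0 by exact: pick_coord_neq0.
(* This [c] kills coordinate [i] of [d]; equality of the ratios then kills coordinate [k] as
   well. *)
pose c := frame_coord e i w / frame_coord e i v.
pose d := w - c *: v.
have coordd l : frame_coord e l d = frame_coord e l w - c * frame_coord e l v.
  by rewrite /d -scaleNr frame_coordD frame_coordZ mulNr.
have di : frame_coord e i d = 0 by rewrite coordd divfK ?subrr.
have dk : frame_coord e k d = 0.
  rewrite coordd (curve_ratioE i k yx yz vy) (curve_ratioE i k tx tz wt) eqr.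
  by rewrite mulrCA (divfK vi) subrr.
pose d1 := \sum_(l < n.+1 | (l < i)%N) frame_coord e l d *: e l.
pose d2 := \sum_(l < n.+1 | (k < l)%N) frame_coord e l d *: e l.
have dE : d = d1 + d2.
  rewrite {1}(frame_decomp unit_e d) (bigID (fun l : 'I_n.+1 => (l < i)%N)) /=.
  congr (_ + _); rewrite [RHS]big_mkcond [LHS]big_mkcond /=; apply: eq_bigr => l _.
  case: ltnP => il /=; first by case: ltnP => // kl; lia.
  case: ltnP => kl //; have [->|->] : l = i \/ l = k.
  - have [h|h] : (l = i :> nat) \/ (l = k :> nat) by lia.
    + by left; apply: val_inj.
    + by right; apply: val_inj.
  - by rewrite di scale0r.
  - by rewrite dk scale0r.
have kn := ltn_ord k.
have d1x : d1 \in xi x i.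
  by apply/attr => [|l il]; [exact/ltnW/ltn_ord | rewrite frame_coord_partial_sum // ltnNge ?ik ?il].
have d2z : d2 \in xi z (n.+1 - k.+1)%N.
  apply/rep => [|l il]; [exact: leq_subr | rewrite frame_coord_partial_sum //; case: ltnP => //; lia].
suff w0 : w = 0 by move: wi; rewrite w0 frame_coord0 eqxx.
apply: (frenet4 frenet_xi xz (nesym yx) (nesym yz) (nesym tx) (nesym tz) yt _ (rpredNr d1x)
  (rpredNr d2z) (rpredNr (memvZ c vy)) wt); first by lia.
rewrite -addrA [- _ + w]addrC -/d dE.
by rewrite addrACA addNr addNr addr0.
Qed.

Lemma frenet_cvg (y : nat -> circle R) t : grass_cvg (fun s => val (y s)) (val t) ->
  grass_cvg (fun s => xi (y s) 1%N) (xi t 1%N).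
Proof.
move=> yt; case: frenet_xi => _ _ /(_ 1%N (fun s _ => y s) (fun=> 1%N) t).
rewrite big_ord_recl big_ord0 addn0 => H.
rewrite (_ : (fun s => _) = (fun s => \sum_(i < 1) xi (y s) 1)%VS); last first.
  by apply/funext => s; rewrite big_ord_recl big_ord0 addv0.
by apply: H => // s i i' _; apply: val_inj; case: i i' => [[]] // ? [[]].
Qed.

(** The limit axiom for two points, one moving and the other held at [t]; [y s <> t] supplies the
    required distinctness. *)
Lemma frenet_cvg2 (y : nat -> circle R) t k : grass_cvg (fun s => val (y s)) (val t) ->
  (forall s, y s <> t) -> (0 < k)%N -> (k < n.+1)%N ->
  grass_cvg (fun s => (xi (y s) 1%N + xi t k)%VS) (xi t k.+1).
Proof.
move=> yt yNt k0 kn.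
case: frenet_xi => _ _ /(_ 2%N (fun s => tnth [tuple y s; t]) (tnth [tuple 1%N; k]) t).
rewrite big_ord_recl big_ord_recl big_ord0 addn0 !(tnth_nth 0%N) /= add1n => H.
rewrite (_ : (fun s => _) = (fun s => \sum_(i < 2) xi (tnth [tuple y s; t] i)
    (tnth [tuple 1%N; k] i))%VS); last first.
  by apply/funext => s; rewrite !big_ord_recl big_ord0 addv0 !(tnth_nth 0%N) !(tnth_nth t).
apply: H => //.
- move=> s i i'; rewrite !(tnth_nth t) => H; apply: val_inj; move: i i' H.
  by do 2![case=> [[|[]]] //= _] => // [/yNt | /esym /yNt].
- by move=> i; rewrite (tnth_nth 0%N); case: i => [[|[]]].
- move=> i; under eq_fun do rewrite (tnth_nth t); case: i => [[|[]]] //= _.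
  have [a a0 ta] := pspace_line t.
  by under eq_fun do rewrite ta; rewrite [X in grass_cvg _ X]ta; apply: grass_cvg_vline => //; exact: cvg_cst.
Qed.

Lemma frame_row_mul i v : frame_row e i *m v = (frame_coord e i v)%:M.
Proof. by rewrite [LHS]mx11_scalar. Qed.

Lemma curve_ratio_cvg i k (y : nat -> circle R) t :
  (forall s, y s <> x) -> (forall s, y s <> z) -> t <> x -> t <> z ->
  grass_cvg (fun s => val (y s)) (val t) ->
  (fun s => curve_ratio i k (y s)) @ \oo --> curve_ratio i k t.
Proof.
move=> yx yz tx tz /frenet_cvg yt.
apply: (grass_cvg_ratio (phi := frame_row e k) (psi := frame_row e i) yt).
- by move=> s w ws; rewrite !frame_row_mul (curve_ratioE i k (yx s) (yz s) ws) scale_scalar_mx.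
- by move=> w ws; rewrite !frame_row_mul (curve_ratioE i k tx tz ws) scale_scalar_mx.
- exists (vpick (xi t 1%N)); first exact: memv_pick.
  rewrite frame_row_mul; apply: contraNneq (pick_coord_neq0 i tx tz).
  by move=> /matrixP/(_ 0 0); rewrite !mxE mulr1n => ->.
Qed.

(** For [i > 0] both coordinates vanish on the limit line, which therefore does not determine the
    limit. Adding [xi x i], where both coordinates vanish, leaves the ratio unchanged, and the limit
    space [xi x i.+1] is killed by coordinate [k] but contains [e i]. *)
Lemma curve_ratio_cvg0 (i k : 'I_n.+1) (y : nat -> circle R) : k = i.+1 :> nat ->
  (forall s, y s <> x) -> (forall s, y s <> z) ->
  grass_cvg (fun s => val (y s)) (val x) ->
  (fun s => curve_ratio i k (y s)) @ \oo --> (0 : R).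
Proof.
move=> ki yx yz yt.
have kn := ltn_ord k.
have {yt} cvgU : grass_cvg (fun s => (xi (y s) 1%N + xi x i)%VS) (xi x i.+1).
  (* For [i = 0] the added space is zero and the one-point limit is enough. *)
  have [i0|i0] := posnP i; last by apply: frenet_cvg2.
  rewrite i0; have -> : xi x 0 = 0%VS.
    by apply/eqP; rewrite -dimv_eq0 (frenet_flag frenet_xi x).1.
  under eq_fun do rewrite addv0; exact: frenet_cvg.
apply: (grass_cvg_ratio (phi := frame_row e k) (psi := frame_row e i) cvgU).
- move=> s _ /memv_addP[u us [w ws ->]].
  rewrite !frame_row_mul !frame_coordD (curve_ratioE i k (yx s) (yz s) us).
  have h := (attr w (ltnW (ltn_ord i))).1 ws.
  by rewrite !h ?addr0 ?scale_scalar_mx //; lia.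
- move=> w /(attr w (ltn_ord i)).1 h; rewrite !frame_row_mul h ?ki //.
  by rewrite scale0r raddf0.
- have unit_e := osc_unit osc_e; exists (e i).
    apply/attr => [|l il]; first exact: ltn_ord.
    by rewrite frame_coord_basis //; case: eqP il => // ->; rewrite ltnn.
  rewrite frame_row_mul frame_coord_basis // eqxx; apply/eqP => /matrixP/(_ 0 0)/eqP.
  by rewrite !mxE mulr1n oner_eq0.
Qed.

End CurveRatios.

(** * Functions on a half-line with a multiplicative scaling law *)

Section Ray.
Variables (R : realType).

(** Sequential continuity, where a sequence tending to [t] is replaced by its maximum with [t / 2]:
    this is positive and eventually the same sequence. *)
Lemma continuous_ray (G : R -> R) (t : R) : 0 < t ->
  (forall u : nat -> R, (forall s, 0 < u s) -> u @ \oo --> t ->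
    (fun s => G (u s)) @ \oo --> G t) ->
  {for t, continuous G}.
Proof.
move=> t0 hG; rewrite /prop_for; apply/(@cvg_nbhsP _ R^o) => u ut.
have t2 : t / 2 < t by rewrite ltr_pdivrMr // ltr_pMr // ltr1n.
have ev : \forall s \near \oo, Num.max (u s) (t / 2) = u s.
  have : \forall s \near \oo, t / 2 < u s by exact: (cvgr_gt t ut).
  by apply: filterS => s /ltW h; rewrite max_l.
have /hG H s : 0 < Num.max (u s) (t / 2) by rewrite lt_max divr_gt0 ?orbT.
apply: cvg_trans (H _).
  by apply: near_eq_cvg; apply: filterS ev => s ->.
apply: cvg_trans ut.
by apply: near_eq_cvg; apply: filterS ev => s ->.
Qed.

Variables (G : R -> R) (kappa theta : R).
Hypothesis contG : forall t, 0 < t -> {for t, continuous G}.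
Hypothesis injG : forall s t, 0 < s -> 0 < t -> G s = G t -> s = t.
Hypothesis G0 : forall t, 0 < t -> G t != 0.

(** A change of sign would produce a zero by the intermediate value theorem. *)
Lemma ray_sign s t : 0 < s -> 0 < t -> 0 < G s * G t.
Proof.
wlog st : s t / s <= t.
  move=> W s0 t0; have [st|/ltW ts] := leP s t; first exact: W.
  by rewrite mulrC W.
move=> s0 t0; rewrite lt_neqAle eq_sym mulf_neq0 ?G0 //= leNgt; apply/negP => neg.
have cont : {within `[s, t], continuous G}.
  apply: continuous_in_subspaceT => u /set_mem; rewrite /= in_itv /= => /andP[su _].
  by apply: contG; apply: lt_le_trans su.
have [|u] := @IVT R G s t 0 st cont.
  rewrite ge_min le_max; apply/andP; split; apply: contraLR neg;
    rewrite negb_or -!ltNge -leNgt => /andP[/ltW Gs /ltW Gt].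
    exact: mulr_ge0.
  exact: mulr_le0.
rewrite in_itv /= => /andP[su _] Gu.
by have := G0 (lt_le_trans s0 su); rewrite Gu eqxx.
Qed.

Hypotheses (kappa0 : 0 < kappa) (theta1 : `|theta| < 1).
Hypothesis scaleG : forall t, 0 < t -> G (kappa * t) = theta * G t.

Lemma ray_scale_gt0 : 0 < theta.
Proof.
have k1 : 0 < kappa * 1 by rewrite mulr1.
have := ray_sign ltr01 k1; rewrite scaleG // mulrCA -expr2.
by rewrite pmulr_lgt0 // exprn_even_gt0 // G0.
Qed.

(** The sign of [G] being constant, its absolute value is still injective, hence strictly monotone.
    Comparing the values at [1] and [kappa] gives the direction, which depends on [kappa] only and
    so is common to all functions with the same [kappa]. *)
Lemma ray_monotone s t : 0 < s -> s < t ->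
  if kappa < 1 then `|G s| < `|G t| else `|G t| < `|G s|.
Proof.
have contN : {within [set` `]0, +oo[], continuous (fun t => `|G t|)}.
  apply: continuous_in_subspaceT => u /set_mem; rewrite /= in_itv /= andbT => u0.
  exact: (cvg_norm (contG u0)).
have injN : {in `]0, +oo[ &, injective (fun t => `|G t|)}.
  move=> u v; rewrite !in_itv /= !andbT => u0 v0 /eqP.
  rewrite eqr_norm2 => /orP[/eqP|/eqP h]; first exact: injG.
  by have := ray_sign u0 v0; rewrite h mulNr oppr_gt0 ltNge sqr_ge0.
have scale_lt u : 0 < u -> `|G (kappa * u)| < `|G u|.
  by move=> u0; rewrite scaleG // normrM gtr_pMl // normr_gt0 G0.
move=> s0 st.
have t0 := lt_trans s0 st.
have [mono|mono] := itv_continuous_inj_mono contN injN.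
- have -> : kappa < 1; last by apply: (mono s t _ _ st); rewrite in_itv /= andbT.
  rewrite ltNge; apply/negP; rewrite le_eqVlt => /orP[/eqP k1|k1].
    by have := scale_lt 1 ltr01; rewrite -k1 mulr1 ltxx.
  have := mono 1 (kappa * 1); rewrite !in_itv /= !andbT mulr1 => /(_ ltr01 kappa0 k1).
  by apply/negP; rewrite -leNgt ltW // -[X in G X]mulr1 scale_lt.
- have -> : (kappa < 1) = false; last by apply: (mono t s _ _ st); rewrite in_itv /= andbT.
  apply/negP => k1.
  have := mono 1 (kappa * 1); rewrite !in_itv /= !andbT mulr1 => /(_ ltr01 kappa0 k1).
  by apply/negP; rewrite -leNgt ltW // -[X in G X]mulr1 scale_lt.
Qed.

End Ray.

(** * An affine chart of the circle at two points *)

Section CirclePoints.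
Variables (R : realType) (x z : circle R) (p m : 'cV[R]_2).
Hypotheses (xz : x <> z) (xp : val x = <[p]>%VS) (zm : val z = <[m]>%VS).

Lemma volume2 (a b : 'cV[R]_2) : volume [:: a; b] = a 0 0 * b 1 0 - a 1 0 * b 0 0.
Proof.
rewrite /volume (expand_det_col _ 0) !big_ord_recl big_ord0 addr0 /cofactor.
rewrite !det_mx11 !mxE /=.
have -> : lift (lift ord0 ord0) 0 = 0 :> 'I_2 by exact: val_inj.
have -> : lift ord0 0 = 1 :> 'I_2 by exact: val_inj.
by rewrite expr0 expr1 mul1r mulN1r mulrN.
Qed.

Lemma line_neq0 (y : circle R) a : val y = <[a]>%VS -> a != 0.
Proof.
move=> ya; have := eqP (valP y); rewrite ya dim_vline; by case: (a != 0).
Qed.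

Lemma circle_vec_eq0 s t : s *: p + t *: m = 0 -> t = 0 /\ s = 0.
Proof.
have p0 := line_neq0 xp; have m0 := line_neq0 zm.
move=> h; have t0 : t = 0.
  apply/eqP/negPn/negP => tn; apply: xz; apply: val_inj; rewrite /= xp zm.
  apply/eqP; rewrite eq_sym eqEdim !dim_vline p0 m0 andbT -memvE.
  apply/vlineP; exists (- (s / t)).
  apply: (scalerI tn); rewrite scalerA mulrN mulrCA divff // mulr1 scaleNr.
  by apply/eqP; rewrite -addr_eq0 addrC h.
split=> //; move: h; rewrite t0 scale0r addr0 => /eqP.
by rewrite scaler_eq0 (negPf p0) orbF => /eqP.
Qed.

Lemma circle_free : free [:: p; m].
Proof.
apply/(freeP (X := [tuple p; m])) => k; rewrite !big_ord_recl big_ord0 addr0 /=.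
move=> /circle_vec_eq0[k1 k0] i; case: i => [[|[|//]]] hi; [rewrite -k0 | rewrite -k1];
  congr k; exact: val_inj.
Qed.

Lemma circle_decomp (b : 'cV[R]_2) : exists s t, b = s *: p + t *: m.
Proof.
have : b \in <<[:: p; m]>>%VS.
  suff -> : <<[:: p; m]>>%VS = fullv by exact: memvf.
  apply/eqP; rewrite eqEdim subvf (eqP circle_free) dimvf /dim /=.
  by [].
rewrite span_cons span_seq1 => /memv_addP[_ /vlineP[s ->] [_ /vlineP[t ->] ->]].
by exists s, t.
Qed.

(** The chart sends 0 to [x] and omits [z]; positive and negative parameters are the two arcs
    between them. *)
Lemma circle_chart : exists c : R -> circle R, forall t, val (c t) = <[p + t *: m]>%VS.
Proof.
suff H t : exists y : circle R, val y = <[p + t *: m]>%VS by have [c hc] := choice H; exists c.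
have h : \dim <[p + t *: m]>%VS == 1%N.
  rewrite dim_vline eqb1; apply/eqP; rewrite -[p in p + _]scale1r => /circle_vec_eq0[_ /eqP].
  by rewrite oner_eq0.
by exists (exist (fun U : {vspace 'cV[R]_2} => \dim U == 1%N) _ h).
Qed.

Lemma vline_eqP (a b : 'cV[R]_2) : <[a]>%VS = <[b]>%VS -> exists s, a = s *: b.
Proof. by move=> ab; apply/vlineP; rewrite -ab memv_line. Qed.

Lemma chart_inj s t : <[p + s *: m]>%VS = <[p + t *: m]>%VS -> s = t.
Proof.
move=> /vline_eqP[r] /eqP; rewrite -subr_eq0 scalerDr scalerA opprD addrACA.
rewrite -[p in p - _]scale1r -!scalerBl => /eqP/circle_vec_eq0[h1 h2].
move/eqP: h2; rewrite subr_eq0 => /eqP r1.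
by apply/eqP; rewrite -subr_eq0 -[t]mul1r r1 h1.
Qed.

Lemma chart_neq_rep t : <[p + t *: m]>%VS <> <[m]>%VS.
Proof.
move=> /vline_eqP[r] /eqP; rewrite -subr_eq0 -addrA -scalerBl -[p in p + _]scale1r.
by move=> /eqP/circle_vec_eq0[_ /eqP]; rewrite oner_eq0.
Qed.

Lemma chart_neq_attr t : t != 0 -> <[p + t *: m]>%VS <> <[p]>%VS.
Proof.
move=> /eqP t0 h; apply: t0; apply: chart_inj.
by rewrite scale0r addr0.
Qed.

(** If [s *: p + t *: m] spans the third line, the orientation product is [s * t] times a
    nonnegative factor. So [s * t > 0], and the parameter [t / s] is positive. *)
Lemma positive_chart (y : circle R) : 0 < volume [:: m; p] -> positive_triple z x y ->
  exists2 t, 0 < t & val y = <[p + t *: m]>%VS.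
Proof.
move=> vpos [a [b [c [za xb yc]]]].
have [al ->] : exists al, a = al *: m by apply: vline_eqP; rewrite -za.
have [be ->] : exists be, b = be *: p by apply: vline_eqP; rewrite -xb.
have [s [t cE]] := circle_decomp c.
have -> : volume [:: al *: m; be *: p] * volume [:: be *: p; c] * volume [:: c; al *: m] =
    (s * t) * ((al * be) ^+ 2 * volume [:: m; p] ^+ 3).
  by rewrite cE !volume2 !mxE; ring.
move=> h; have st : 0 < s * t.
  have k0 : 0 <= (al * be) ^+ 2 * volume [:: m; p] ^+ 3.
    by rewrite mulr_ge0 ?sqr_ge0 // exprn_ge0 // ltW.
  rewrite ltNge; apply/negP => st; move: h; rewrite ltNge => /negP; apply.
  exact: mulr_le0_ge0.
have s0 : s != 0 by apply: contraTneq st => ->; rewrite mul0r ltxx.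
exists (t / s).
  have -> : t / s = s * t * s^-1 ^+ 2 by field.
  by rewrite mulr_gt0 // exprn_even_gt0 //= invr_eq0.
rewrite yc cE; apply/eqP; rewrite eqEsubv -!memvE; apply/andP; split; apply/vlineP.
  by exists s; rewrite scalerDr scalerA mulrCA divff // mulr1.
exists s^-1; by rewrite scalerDr !scalerA mulVf // scale1r mulrC.
Qed.

End CirclePoints.

(** * An equivariant curve near a hyperbolic element *)

Section Loxodromic.
Variables (R : realType) (n : nat) (xi : circle R -> nat -> {vspace 'cV[R]_n.+1}).
Hypothesis frenet_xi : frenet xi.
Variables (A : psl R 2) (T : psl R n.+1).
Hypothesis equiv_xi :
  forall y k, (k <= n.+1)%N -> xi (pact A y) k = act T (xi y k).
Variables (z x : circle R) (e : 'I_n.+1 -> 'cV[R]_n.+1).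
Hypotheses (fixA : fixed_points A z x) (osc_e : osculating_frame xi x z e).

Let M := slval (slrep T).

Let xz : x <> z. Proof. by case: fixA => /nesym. Qed.
Let unit_e : frame_mx e \in unitmx := osc_unit osc_e.

(** A diagonal entry of a representative defined up to sign, so that only ratios and absolute values
    are intrinsic. *)
Definition osc_eigenvalue (i : 'I_n.+1) : R := frame_coord e i (M *m e i).

(** The line of [e i] is the intersection of an osculating space at [x] with one at [z], and
    equivariance makes both invariant. *)
Lemma osc_eigenvector i : M *m e i = osc_eigenvalue i *: e i.
Proof.
have img y k : pact A y = y -> (k <= n.+1)%N -> e i \in xi y k -> M *m e i \in xi y k.
  by move=> Ay kn h; rewrite -Ay equiv_xi //; apply/vimageP; exists (e i).
have [_ Az Ax _ _] := fixA.
have eix : e i \in xi x i.+1.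
  apply/(osc_attr osc_e) => [|k ik]; first exact: ltn_ord.
  by rewrite frame_coord_basis //; case: eqP ik => // ->; rewrite ltnn.
have eiz : e i \in xi z (n.+1 - i).
  apply/(osc_rep osc_e) => [|k]; first exact: leq_subr.
  rewrite subKn ?(ltnW (ltn_ord i)) // => ki.
  by rewrite frame_coord_basis //; case: eqP ki => // ->; rewrite ltnn.
have Mx := img _ _ Ax (ltn_ord i) eix.
have Mz := img _ _ Az (leq_subr _ _) eiz.
rewrite [LHS](frame_decomp unit_e) (bigD1 i) //= big1 ?addr0 // => k ki.
have [lt|gt|/val_inj eq] := ltngtP k i; last by rewrite eq eqxx in ki.
- rewrite ((osc_rep osc_e _ (leq_subr _ _)).1 Mz) ?scale0r //.
  by rewrite subKn ?(ltnW (ltn_ord i)).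
- by rewrite ((osc_attr osc_e _ (ltn_ord i)).1 Mx) ?scale0r.
Qed.

Lemma osc_coord_mul i a : frame_coord e i (M *m a) = osc_eigenvalue i * frame_coord e i a.
Proof.
rewrite {1}(frame_decomp unit_e a) mulmx_sumr.
rewrite (eq_bigr (fun k => (frame_coord e k a * osc_eigenvalue k) *: e k)).
  by rewrite frame_coord_sum // mulrC.
by move=> k _; rewrite -scalemxAr osc_eigenvector scalerA.
Qed.

Lemma osc_eigenvalue_neq0 i : osc_eigenvalue i != 0.
Proof.
apply/eqP => l0; have := osc_eigenvector i; rewrite l0 scale0r => Me.
have e0 : e i = 0 by rewrite -[e i](mulKmx (sl_unitmx (slrep T))) Me mulmx0.
have := frame_coord_basis unit_e i i; rewrite e0 frame_coord0 eqxx => /eqP.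
by rewrite eq_sym oner_eq0.
Qed.

Lemma pact_neq_fixed y t : pact A t = t -> y <> t -> pact A y <> t.
Proof. by move=> At yt h; apply: yt; apply: (can_inj (pactK A)); rewrite At. Qed.

Lemma osc_ratio_pact i k y : y <> x -> y <> z ->
  curve_ratio xi e i k (pact A y) =
  osc_eigenvalue k / osc_eigenvalue i * curve_ratio xi e i k y.
Proof.
move=> yx yz; have [_ Az Ax _ _] := fixA.
have Ayx := pact_neq_fixed Ax yx; have Ayz := pact_neq_fixed Az yz.
set v := vpick (xi y 1%N).
have vy : v \in xi y 1%N by exact: memv_pick.
have Mv : M *m v \in xi (pact A y) 1%N by rewrite equiv_xi //; apply/vimageP; exists v.
have := curve_ratioE frenet_xi xz osc_e i k Ayx Ayz Mv.
rewrite !osc_coord_mul (curve_ratioE frenet_xi xz osc_e i k yx yz vy).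
have vi : frame_coord e i v != 0 by exact: (pick_coord_neq0 frenet_xi xz osc_e).
have li := osc_eigenvalue_neq0 i.
move=> h; apply: (mulIf (mulf_neq0 li vi)); rewrite -h.
by field.
Qed.

(** The iterates of [y] tend to [x], where the ratio tends to 0, while each iteration multiplies it
    by the quotient of eigenvalues; a quotient of absolute value at least 1 would prevent this. *)
Lemma osc_eigenvalue_lt (i k : 'I_n.+1) y : k = i.+1 :> nat -> y <> x -> y <> z ->
  `|osc_eigenvalue k / osc_eigenvalue i| < 1.
Proof.
move=> ki yx yz; have [_ Az Ax cvgx _] := fixA.
have iterA s : [/\ pact (A ^+ s)%g y <> x, pact (A ^+ s)%g y <> z &
    curve_ratio xi e i k (pact (A ^+ s)%g y) =
    (osc_eigenvalue k / osc_eigenvalue i) ^+ s * curve_ratio xi e i k y].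
  elim: s => [|s [IHx IHz IHr]]; first by rewrite expg0 pact1 expr0 mul1r.
  rewrite expgS pact_mul; split; [exact: pact_neq_fixed | exact: pact_neq_fixed |].
  by rewrite osc_ratio_pact // IHr exprS mulrA.
have := curve_ratio_cvg0 frenet_xi xz osc_e ki (y := fun s => pact (A ^+ s)%g y).
move=> /(_ _ _ (cvgx y yz)) cvg0.
have {}cvg0 := cvg0 (fun s => let: And3 h _ _ := iterA s in h)
  (fun s => let: And3 _ h _ := iterA s in h).
have r0 := curve_ratio_neq0 frenet_xi xz osc_e i k yx yz.
rewrite ltNge; apply/negP => th1.
have : \forall s \near \oo, `|curve_ratio xi e i k (pact (A ^+ s)%g y)| <
    `|curve_ratio xi e i k y|.
  by apply: (cvgr0_norm_lt _ cvg0); rewrite normr_gt0.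
move=> [s _ /(_ s (leqnn s))] /=; case: (iterA s) => _ _ ->.
rewrite normrM normrX gtr_pMl ?normr_gt0 // ltNge => /negP; apply.
exact: exprn_ege1.
Qed.

Variables (p m : 'cV[R]_2) (c : R -> circle R).
Hypotheses (xp : val x = <[p]>%VS) (zm : val z = <[m]>%VS).
Hypothesis chart : forall t, val (c t) = <[p + t *: m]>%VS.

Lemma chart_neq_fixed t : 0 < t -> c t <> x /\ c t <> z.
Proof.
move=> t0; split=> h.
- apply: (chart_neq_attr xz xp zm (lt0r_neq0 t0)); by rewrite -chart -xp h.
- by apply: (chart_neq_rep xz xp zm (t := t)); rewrite -chart -zm h.
Qed.

(** If [mu] and [nu] are the eigenvalues on [p] and [m], the factor is [nu / mu]. Determinant 1
    gives [mu * nu = 1], so it is the square of [mu^-1], and each arc is preserved. *)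
Lemma chart_pact : exists2 kappa, 0 < kappa & forall t, pact A (c t) = c (kappa * t).
Proof.
have [_ Az Ax _ _] := fixA.
set S := slval (slrep A).
have fixS y a : pact A y = y -> val y = <[a]>%VS -> exists mu, S *m a = mu *: a.
  move=> Ay ya; apply/vlineP; rewrite -ya -Ay; apply/vimageP; exists a => //.
  by rewrite ya memv_line.
have [mu Sp] := fixS _ _ Ax xp; have [nu Sm] := fixS _ _ Az zm.
have vol0 : volume [:: p; m] != 0 by apply: volume_free (circle_free xz xp zm).
have munu : mu * nu = 1.
  have := volume_mulmx S (s := [:: p; m]) isT.
  rewrite sl_detE mul1r /= Sp Sm => h.
  apply: (mulIf vol0); rewrite mul1r -[RHS]h !volume2 !mxE; ring.
have mu0 : mu != 0 by apply: contraTneq (oner_neq0 R) => mu0; rewrite -munu mu0 mul0r eqxx.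
exists (nu / mu).
  have -> : nu / mu = (mu * nu) * mu^-1 ^+ 2 by field.
  by rewrite munu mul1r exprn_even_gt0 //= invr_eq0.
move=> t; apply: val_inj; rewrite /= !chart.
apply/eqP; rewrite eq_sym eqEdim dim_act !dim_vline !(line_neq0 (chart _)) leqnn andbT.
rewrite -memvE; apply/vimageP; exists (mu^-1 *: (p + t *: m)).
  by rewrite memvZ ?memv_line.
rewrite -/S -scalemxAr mulmxDr -scalemxAr Sp Sm scalerDr !scalerA mulVf // scale1r.
by congr (_ + _ *: _); ring.
Qed.

Local Notation G i k t := (curve_ratio xi e i k (c t)).

Lemma chart_ratio_cont i k t : 0 < t -> {for t, continuous (fun s => G i k s)}.
Proof.
move=> t0; apply: continuous_ray => // u u0 ut.
have [tx tz] := chart_neq_fixed t0.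
apply: (curve_ratio_cvg frenet_xi xz osc_e) => //.
- by move=> s; have [] := chart_neq_fixed (u0 s).
- by move=> s; have [] := chart_neq_fixed (u0 s).
under eq_fun do rewrite chart; rewrite [X in grass_cvg _ X]chart.
apply: grass_cvg_vline; first by apply: (line_neq0 (chart t)).
apply: cvgD; first exact: cvg_cst.
exact: cvgZl.
Qed.

Lemma chart_ratio_inj (i k : 'I_n.+1) s t : k = i.+1 :> nat -> 0 < s -> 0 < t ->
  G i k s = G i k t -> s = t.
Proof.
move=> ki s0 t0 h; have [sx sz] := chart_neq_fixed s0; have [tx tz] := chart_neq_fixed t0.
have := curve_ratio_inj frenet_xi xz osc_e ki sx sz tx tz h.
by move=> /(congr1 val); rewrite !chart => /(chart_inj xz xp zm).
Qed.

Lemma chart_ratio_neq0 i k t : 0 < t -> G i k t != 0.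
Proof.
by move=> t0; have [tx tz] := chart_neq_fixed t0; apply: (curve_ratio_neq0 frenet_xi xz osc_e).
Qed.

(** Positivity holds because [A] preserves the arc, on which the ratio keeps its sign. *)
Lemma osc_eigenvalue_step (i k : 'I_n.+1) : k = i.+1 :> nat ->
  0 < osc_eigenvalue k / osc_eigenvalue i < 1.
Proof.
move=> ki; have [kappa k0 Ac] := chart_pact.
have [c1x c1z] := chart_neq_fixed ltr01.
have lt1 := osc_eigenvalue_lt ki c1x c1z.
have scaleG t : 0 < t -> G i k (kappa * t) = osc_eigenvalue k / osc_eigenvalue i * G i k t.
  by move=> t0; rewrite -Ac osc_ratio_pact //; have [] := chart_neq_fixed t0.
have th0 := ray_scale_gt0 (@chart_ratio_cont i k) (@chart_ratio_neq0 i k) k0 scaleG.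
by rewrite th0 -(gtr0_norm th0).
Qed.

Lemma osc_eigenvalue_ratio_chart (i k : 'I_n.+1) : (i < k)%N ->
  0 < osc_eigenvalue k / osc_eigenvalue i < 1.
Proof.
case: k => k; elim: k => // k IH kn /=; rewrite ltnS leq_eqVlt => /orP[/eqP ik|ik].
  by apply: osc_eigenvalue_step; rewrite /= ik.
have /andP[h0 h1] := IH (ltnW kn) ik.
have /andP[g0 g1] := osc_eigenvalue_step (i := Ordinal (ltnW kn)) (k := Ordinal kn) erefl.
have lk := osc_eigenvalue_neq0 (Ordinal (ltnW kn)).
have -> : osc_eigenvalue (Ordinal kn) / osc_eigenvalue i =
    (osc_eigenvalue (Ordinal kn) / osc_eigenvalue (Ordinal (ltnW kn))) *
    (osc_eigenvalue (Ordinal (ltnW kn)) / osc_eigenvalue i).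
  by rewrite mulrA divfK.
by rewrite mulr_gt0 //= mulr_ilt1 // ltW.
Qed.

Lemma chart_ratio_prod t : 0 < t ->
  G ord0 ord_max t = \prod_(0 <= i < n) G (inord i) (inord i.+1) t.
Proof.
move=> t0; have [tx tz] := chart_neq_fixed t0.
have nz i := pick_coord_neq0 frenet_xi xz osc_e i tx tz.
have [n0|n0] := posnP n.
  rewrite big_geq ?n0 // /curve_ratio.
  have -> : ord_max = ord0 :> 'I_n.+1 by apply: val_inj; rewrite /= n0.
  by rewrite divff.
rewrite /curve_ratio.
rewrite (telescope_prodf (f := fun i => frame_coord e (inord i) (vpick (xi (c t) 1%N)))) //.
by congr (frame_coord e _ _ / frame_coord e _ _); apply: val_inj; rewrite /= inordK.
Qed.

(** By [chart_ratio_prod] the ratio telescopes into consecutive ones. Their absolute values are all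
    strictly monotone in the direction set by [kappa], hence so is the product; [0 < n] makes it
    nonempty. *)
Lemma chart_ratio_max_inj s t : (0 < n)%N -> 0 < s -> 0 < t ->
  G ord0 ord_max s = G ord0 ord_max t -> s = t.
Proof.
move=> n0; wlog st : s t / s <= t.
  move=> W s0 t0 h; have [st|/ltW ts] := leP s t; first exact: W.
  by apply/esym/W.
move=> s0 t0 /(congr1 Num.norm).
move: st; rewrite le_eqVlt => /orP[/eqP //|st].
rewrite !chart_ratio_prod // !normr_prod.
have [kappa k0 Ac] := chart_pact.
have mono i : (i < n)%N -> if kappa < 1
    then `|G (inord i) (inord i.+1) s| < `|G (inord i) (inord i.+1) t|
    else `|G (inord i) (inord i.+1) t| < `|G (inord i) (inord i.+1) s|.
  move=> i_n; have ki : (inord i.+1 : 'I_n.+1) = (inord i : 'I_n.+1).+1 :> nat.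
    by rewrite !inordK // ltnW.
  have [c1x c1z] := chart_neq_fixed ltr01.
  apply: (ray_monotone (@chart_ratio_cont _ _) _ (@chart_ratio_neq0 _ _) k0
    (osc_eigenvalue_lt ki c1x c1z)) => //.
  - by move=> a b; apply: chart_ratio_inj.
  - by move=> r r0; rewrite -Ac osc_ratio_pact //; have [] := chart_neq_fixed r0.
case: (kappa < 1) mono => mono eqG; exfalso; move: (eqG); apply/eqP.
- rewrite lt_eqF // ltr_prod_nat // => i /andP[_ i_n].
  by rewrite normr_ge0 mono.
- rewrite gt_eqF // ltr_prod_nat // => i /andP[_ i_n].
  by rewrite normr_ge0 mono.
Qed.

Lemma chart_ratio_max_sign s t : 0 < s -> 0 < t ->
  0 < G ord0 ord_max s * G ord0 ord_max t.
Proof. exact: ray_sign (@chart_ratio_cont _ _) (@chart_ratio_neq0 _ _) _ _. Qed.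

End Loxodromic.

(** * Ordered eigenlines are the lines of the osculating frame *)

Section Eigenlines.

(** An increasing self-map satisfies [i <= s i]; applying this to its conjugate by [rev_ord] gives
    the reverse inequality. *)
Lemma ord_increasing_id (N : nat) (s : 'I_N -> 'I_N) :
  (forall i k : 'I_N, (i < k)%N -> (s i < s k)%N) -> forall i, s i = i.
Proof.
move=> incr.
have ge (t : 'I_N -> 'I_N) : (forall i k : 'I_N, (i < k)%N -> (t i < t k)%N) ->
    forall i : 'I_N, (i <= t i)%N.
  move=> tincr [k]; elim: k => // k IH kN.
  by apply: leq_ltn_trans (IH (ltnW kN)) _; apply: tincr.
have le (i : 'I_N) : (s i <= i)%N.
  have := ge (fun i => rev_ord (s (rev_ord i))) _ (rev_ord i).
  rewrite rev_ordK /=; have := ltn_ord i; have := ltn_ord (s i).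
  move=> h1 h2 /(_ _); suff H (j k : 'I_N) : (j < k)%N ->
      (N - (s (rev_ord j)).+1 < N - (s (rev_ord k)).+1)%N by move=> /(_ H); lia.
  move=> jk; have := incr (rev_ord k) (rev_ord j).
  rewrite /=; have := ltn_ord k; have := ltn_ord (s (rev_ord j)); lia.
by move=> i; apply: val_inj; apply/eqP; rewrite eqn_leq le ge.
Qed.

Variables (R : realType) (n : nat) (xi : circle R -> nat -> {vspace 'cV[R]_n.+1}).
Hypothesis frenet_xi : frenet xi.
Variables (A : psl R 2) (T : psl R n.+1).
Hypothesis equiv_xi :
  forall y k, (k <= n.+1)%N -> xi (pact A y) k = act T (xi y k).
Variables (z x : circle R) (e : 'I_n.+1 -> 'cV[R]_n.+1).
Hypotheses (fixA : fixed_points A z x) (osc_e : osculating_frame xi x z e).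

Let unit_e : frame_mx e \in unitmx := osc_unit osc_e.

Lemma osc_eigenvalue_ratio (i k : 'I_n.+1) : (i < k)%N ->
  0 < osc_eigenvalue T e k / osc_eigenvalue T e i < 1.
Proof.
have [p _ xp] := pspace_line x; have [m _ zm] := pspace_line z.
have xz : x <> z by case: fixA => /nesym.
have [c chart] := circle_chart xz xp zm.
exact: (osc_eigenvalue_ratio_chart frenet_xi equiv_xi fixA osc_e xp zm chart).
Qed.

Lemma osc_eigenvalue_norm_lt (i k : 'I_n.+1) : (i < k)%N ->
  `|osc_eigenvalue T e k| < `|osc_eigenvalue T e i|.
Proof.
move=> /osc_eigenvalue_ratio /andP[h0 h1].
have li : osc_eigenvalue T e i != 0 by apply: contraTneq h0 => ->; rewrite invr0 mulr0 ltxx.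
rewrite -[X in `|X| < _](divfK li) normrM gtr_pMl ?normr_gt0 //.
by rewrite gtr0_norm.
Qed.

(** A nonzero coordinate [s i] of [f i] identifies [l i] with the eigenvalue of index [s i]. The
    strict ordering of the absolute values makes [s] increasing, hence the identity, and kills the
    other coordinates of [f i]. *)
Lemma ordered_eigenlines_osc L : ordered_eigenlines T L -> forall i, L i = <[e i]>%VS.
Proof.
move=> [l [f [injl fL feig lmono]]].
have ex i : exists k, frame_coord e k (f i) != 0.
  have [f0 _] := fL i; apply: contrapT => /forallNP h.
  move/eqP: f0; apply; apply: (frame_coord_eq0 unit_e) => k.
  exact/eqP/negPn/negP/h.
have [s hs] := choice ex.
have coordl i k : osc_eigenvalue T e k * frame_coord e k (f i) = l i * frame_coord e k (f i).
  by rewrite -(osc_coord_mul equiv_xi fixA osc_e) feig frame_coordZ.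
have ls i : l i = osc_eigenvalue T e (s i) by have /(mulIf (hs i)) := coordl i (s i).
have lam_lt (i k : 'I_n.+1) : (i < k)%N -> `|osc_eigenvalue T e k| < `|osc_eigenvalue T e i|.
  exact: osc_eigenvalue_norm_lt.
have sid : forall i, s i = i.
  apply: ord_increasing_id => i k ik; rewrite ltnNge leq_eqVlt; apply/negP => /orP[/eqP|] h.
    have eqs : s k = s i by exact: val_inj.
    have /injl eki : l k = l i by rewrite !ls eqs.
    by rewrite eki ltnn in ik.
  have := lmono _ _ (ltnW ik); rewrite !ls leNgt => /negP; apply; exact: lam_lt.
move=> i; have [_ ->] := fL i.
have fi : f i = frame_coord e i (f i) *: e i.
  rewrite {1}(frame_decomp unit_e (f i)) (bigD1 i) //= big1 ?addr0 // => k ki.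
  have [-> |ck] := eqVneq (frame_coord e k (f i)) 0; first by rewrite scale0r.
  have : osc_eigenvalue T e k = osc_eigenvalue T e i.
    by have /(mulIf ck) -> := coordl i k; rewrite ls sid.
  have [/lam_lt|/lam_lt|/val_inj ei] := ltngtP k i; last by rewrite ei eqxx in ki.
    by move=> + h; rewrite h ltxx.
  by move=> + h; rewrite h ltxx.
have ci : frame_coord e i (f i) != 0 by have := hs i; rewrite sid.
apply/eqP; rewrite eqEsubv -!memvE; apply/andP; split; apply/vlineP.
  by exists (frame_coord e i (f i)).
by exists (frame_coord e i (f i))^-1; rewrite {2}fi scalerK.
Qed.


Lemma osc_line_eq y i : e i \in xi y 1%N -> <[e i]>%VS = xi y 1%N.
Proof.
move=> ei; apply/eqP; rewrite eqEdim -memvE ei (frenet_flag frenet_xi y).1 //.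
rewrite dim_vline lt0b; apply/eqP => e0.
have := frame_coord_basis unit_e i i; rewrite e0 frame_coord0 eqxx => /eqP.
by rewrite eq_sym oner_eq0.
Qed.

(** For [beta], with [v ord0 = ord0], this is the first line of its flag. *)
Lemma first_eigenline L : ordered_eigenlines T L -> L ord0 = xi x 1%N.
Proof.
move=> /ordered_eigenlines_osc ->; apply: osc_line_eq.
apply/(osc_attr osc_e) => // i i0.
by rewrite frame_coord_basis //; case: eqP i0 => // ->.
Qed.

(** For [gamma], with [w ord0 = ord_max], this is the first line of its flag. *)
Lemma last_eigenline L : ordered_eigenlines T L -> L ord_max = xi z 1%N.
Proof.
move=> /ordered_eigenlines_osc ->; apply: osc_line_eq.
apply/(osc_rep osc_e) => // i; rewrite subSS subn0 => i0.
by rewrite frame_coord_basis //; case: eqP i0 => // ->; rewrite ltnn.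
Qed.

End Eigenlines.

(** * Volumes modulo the span of the middle frame vectors *)

Section Pencil.
Variables (R : realType) (n : nat) (e : 'I_n.+2 -> 'cV[R]_n.+2).
Hypothesis unit_e : frame_mx e \in unitmx.

Let c0 := frame_coord e ord0.
Let c1 := frame_coord e ord_max.

(** Modulo the span of [zs], which contains all middle frame vectors, every vector reduces to its
    two extreme coordinates. The volume is an alternating form in these, so it is a multiple of
    their 2 x 2 determinant. *)
Lemma volume_pencil (zs : seq 'cV[R]_n.+2) : size zs = n ->
  (forall k, k != ord0 -> k != ord_max -> e k \in span zs) ->
  forall a b, volume [:: a, b & zs] =
    (c0 a * c1 b - c1 a * c0 b) * volume [:: e ord0, e ord_max & zs].
Proof.
move=> szs ezs.
pose D a b := volume [:: a, b & zs].
have decomp a : exists2 w, w \in span zs & a = c0 a *: e ord0 + (c1 a *: e ord_max + w).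
  exists (\sum_(k | (k != ord0) && (k != ord_max)) frame_coord e k a *: e k).
    by apply: rpred_sum => k /andP[k0 k1]; apply: memvZ; exact: ezs.
  by rewrite {1}(frame_decomp unit_e a) (bigD1 ord0) //= (bigD1 ord_max).
have swap a b : D a b = - D b a by exact: (@volume_swap _ _ [::]).
have alt a : D a a = 0 by apply: (@volume_alternate _ _ _ 0 1).
have span2 a w : w \in span zs -> D a w = 0.
  move=> wz; have := @volume_in_span _ _ [:: a] zs [::] w isT.
  by rewrite cats0 szs; apply.
have lin c a b d : D (c *: a + b) d = c * D a d + D b d.
  exact: (@volume_linear _ _ [::]).
have expand a d : D a d = c0 a * D (e ord0) d + c1 a * D (e ord_max) d.
  by have [w wz {1}->] := decomp a; rewrite !lin [D w d]swap (span2 _ _ wz) oppr0 addr0.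
move=> a b; rewrite -/(D a b) -/(D _ _) expand ![D _ b]swap !(expand b) !alt.
by rewrite [D (e ord_max) (e ord0)]swap; ring.
Qed.

Lemma volume_outer (zs : seq 'cV[R]_n.+2) a b : size zs = n ->
  volume (a :: zs ++ [:: b]) = (-1) ^+ n * volume [:: a, b & zs].
Proof.
move=> szs; have := @volume_move _ _ [:: a] zs [::] b.
rewrite cats0 szs => /(_ (leqnn _)) /= ->.
by rewrite mulrA -exprD addnn -mul2n exprM sqrrN !expr1n mul1r.
Qed.

(** Two vectors each pass [n] others, and the signs cancel. *)
Lemma volume_last (zs : seq 'cV[R]_n.+2) a b : size zs = n ->
  volume (zs ++ [:: a; b]) = volume [:: a, b & zs].
Proof.
move=> szs; have n2 : (0 + n < n.+2)%N by rewrite add0n leqW.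
have := @volume_move _ _ [::] zs [:: b] a.
rewrite szs /= volume_outer // => /(_ n2).
by move=> /(mulfI (expf_neq0 _ _)) -> //; rewrite oppr_eq0 oner_neq0.
Qed.

Variable u : 'S_n.+2.
Hypotheses (u_max : u ord_max = ord_max) (u_pred : u (inord n) = ord0).

(** The conditions on [u] put [ord0] and [ord_max] in the last two positions. So the first [n]
    vectors span the middle of the frame, and the next one adds only the direction of [e ord0]. *)
Lemma weyl_adapted (z : seq 'cV[R]_n.+2) :
  adapted (weyl_flag (fun i => <[e i]>%VS) u) z ->
  [/\ size (take n z) = n, take n.+1 z = take n z ++ [:: z`_n],
      c0 z`_n != 0, c1 z`_n = 0 &
      exists2 D, D != 0 & forall a b,
        volume [:: a, b & take n z] = (c0 a * c1 b - c1 a * c0 b) * D].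
Proof.
move=> [sz fz flagz].
have stk : size (take n z) = n by rewrite size_takel // sz ltnW.
have tkS : take n.+1 z = take n z ++ [:: z`_n].
  by rewrite (take_nth 0) ?sz ?ltnS ?leqnSn // cats1.
have ezs k : k != ord0 -> k != ord_max -> e k \in span (take n z).
  move=> k0 k1; rewrite -flagz ?(leqW (leqnSn _)) //.
  have uk : (u^-1%g k < n)%N.
    have := ltn_ord (u^-1%g k); rewrite ltnS leq_eqVlt => /orP[/eqP h|].
      have kE : u^-1%g k = ord_max by apply: val_inj.
      by move: k1; rewrite -[k](permKV u) kE u_max eqxx.
    rewrite ltnS leq_eqVlt => /orP[/eqP h|//].
    have kE : u^-1%g k = inord n by apply: val_inj; rewrite /= inordK.
    by move: k0; rewrite -[k](permKV u) kE u_pred eqxx.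
  apply: (subvP (sumv_sup (u^-1%g k) uk (subvv _))).
  by rewrite permKV memv_line.
have zn : z`_n \in span (take n.+1 z).
  by apply: memv_span; rewrite tkS mem_cat mem_seq1 eqxx orbT.
have c1n : c1 z`_n = 0.
  move: zn; rewrite -flagz // => /memv_sumP[f fin ->].
  rewrite /c1 (big_morph _ (frame_coordD e ord_max) (frame_coord0 e ord_max)) big1 // => i ilt.
  have /vlineP[r ->] := fin i ilt; rewrite frame_coordZ frame_coord_basis //.
  case: eqP => [/esym h|]; last by rewrite mulr0.
  have iE : i = ord_max by apply: (perm_inj (s := u)); rewrite h u_max.
  by move: ilt; rewrite iE ltnn.
have pencil := volume_pencil stk ezs.
have volz : volume z != 0 by exact: volume_free.
have zE : z = take n z ++ [:: z`_n; z`_n.+1].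
  rewrite -[LHS](take_size z) sz (take_nth 0) ?sz // tkS -cats1 -catA //.
rewrite zE volume_last // pencil c1n mul0r subr0 in volz.
split=> //.
  by apply: contraNneq volz => h; rewrite h !mul0r.
by exists (volume [:: e ord0, e ord_max & take n z]) => //; apply: contraNneq volz => ->; rewrite mulr0.
Qed.

End Pencil.

(** * Cross ratios and edge functions in terms of the extreme ratio [f] *)

Section GapCoordinates.
Variables (R : realType) (n : nat) (xi : circle R -> nat -> {vspace 'cV[R]_n.+2}).
Hypothesis frenet_xi : frenet xi.
Variables (x z : circle R) (e : 'I_n.+2 -> 'cV[R]_n.+2).
Hypotheses (xz : x <> z) (osc_e : osculating_frame xi x z e).

Let unit_e : frame_mx e \in unitmx := osc_unit osc_e.
Let f := curve_ratio xi e ord0 ord_max.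

(** Forms with the same kernel are proportional; the factor is the value of [h] at [e i]. *)
Lemma kernel_form (h : 'rV[R]_n.+2) i : h != 0 ->
  (forall w, h *m w == 0 <-> frame_coord e i w = 0) ->
  exists2 k, k != 0 & forall w, (h *m w) 0 0 = k * frame_coord e i w.
Proof.
move=> h0 hker; exists ((h *m e i) 0 0).
  apply: contraTneq (oner_neq0 R) => k0; rewrite negbK.
  have : h *m e i == 0 by rewrite [h *m _]mx11_scalar k0 raddf0.
  by move=> /hker; rewrite frame_coord_basis // eqxx => /eqP.
move=> w; have : h *m (w - frame_coord e i w *: e i) == 0.
  apply/hker; rewrite -scaleNr frame_coordD frame_coordZ frame_coord_basis // eqxx.
  by rewrite mulr1 subrr.
rewrite mulmxBr -scalemxAr subr_eq0 => /eqP ->.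
by rewrite mxE mulrC.
Qed.

Variable B : circle R -> circle R -> circle R -> circle R -> R.
Hypothesis crossB : is_cross_ratio xi B.

(** The osculating hyperplanes at [x] and [z] are the kernels of the last and the first
    coordinate. *)
Lemma cross_ratio_forms : exists (k l : R) (v : circle R -> 'cV[R]_n.+2),
  [/\ k != 0, l != 0, forall y, v y != 0 /\ v y \in xi y 1%N &
   forall y t,
    B x y z t = ((k * frame_coord e ord_max (v y)) * (l * frame_coord e ord0 (v t))) /
      ((l * frame_coord e ord0 (v y)) * (k * frame_coord e ord_max (v t))) /\
    B z y x t = ((l * frame_coord e ord0 (v y)) * (k * frame_coord e ord_max (v t))) /
      ((k * frame_coord e ord_max (v y)) * (l * frame_coord e ord0 (v t)))].
Proof.
case: crossB => h [v [hv hh hB]].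
have [k k0 hx] : exists2 k, k != 0 & forall w, (h x *m w) 0 0 = k * frame_coord e ord_max w.
  apply: kernel_form => [|w]; first by case: (hh x).
  rewrite -(hh x).2; split.
    by move/(osc_attr osc_e _ (leqnSn n.+1)); apply.
  move=> w0; apply/(osc_attr osc_e _ (leqnSn n.+1)) => i ni.
  by rewrite (_ : i = ord_max) //; apply: val_inj => /=; have := ltn_ord i; lia.
have [l l0 hz] : exists2 l, l != 0 & forall w, (h z *m w) 0 0 = l * frame_coord e ord0 w.
  apply: kernel_form => [|w]; first by case: (hh z).
  rewrite -(hh z).2; split.
    by move/(osc_rep osc_e _ (leqnSn n.+1)); apply; rewrite subSnn.
  move=> w0; apply/(osc_rep osc_e _ (leqnSn n.+1)) => i; rewrite subSnn => i1.
  by rewrite (_ : i = ord0) //; apply: val_inj => /=; lia.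
by exists k, l, v; split=> // y t; rewrite !hB !hx !hz.
Qed.

Lemma cross_ratioE y t : y <> x -> y <> z -> t <> x -> t <> z ->
  B x y z t = f y / f t /\ B z y x t = f t / f y.
Proof.
move=> yx yz tx tz; have [k [l [v [k0 l0 hv hB]]]] := cross_ratio_forms.
have nz i s (sx : s <> x) (sz : s <> z) : frame_coord e i (v s) != 0.
  by case: (hv s) => v0 vs; apply: (curve_coord_neq0 frenet_xi xz osc_e _ sx sz vs v0).
have fE s (sx : s <> x) (sz : s <> z) :
    f s = frame_coord e ord_max (v s) / frame_coord e ord0 (v s).
  have [_ vs] := hv s.
  by rewrite (curve_ratioE frenet_xi xz osc_e ord0 ord_max sx sz vs) mulfK // nz.
have [-> ->] := hB y t; rewrite !fE //.
have := nz ord0 y yx yz; have := nz ord_max y yx yz.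
have := nz ord0 t tx tz; have := nz ord_max t tx tz.
by move=> h1 h2 h3 h4; split; field; rewrite ?h1 ?h2 ?h3 ?h4 ?k0 ?l0.
Qed.

Variable u : 'S_n.+2.
Hypotheses (u_max : u ord_max = ord_max) (u_pred : u (inord n) = ord0).
Let X := weyl_flag (fun i => <[e i]>%VS) u.

Lemma adapted_head (F : nat -> {vspace 'cV[R]_n.+2}) (b : seq 'cV[R]_n.+2) y :
  adapted F b -> F 1%N = xi y 1%N ->
  exists a, [/\ take 1 b = [:: a], a \in xi y 1%N & a != 0].
Proof.
move=> [sb fb flagF] Fy; case: b sb fb flagF => // a b _ fb flagF.
exists a; rewrite /= take0; split => //.
  by rewrite -Fy flagF // /= take0 span_seq1 memv_line.
exact: free_not0 fb (mem_head _ _).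
Qed.

Variables (Y Z W : nat -> {vspace 'cV[R]_n.+2}) (y1 y2 y3 : circle R) (d : R).
Hypotheses (Y1 : Y 1%N = xi y1 1%N) (Z1 : Z 1%N = xi y2 1%N) (W1 : W 1%N = xi y3 1%N).
Hypotheses (y1x : y1 <> x) (y1z : y1 <> z) (y2x : y2 <> x) (y2z : y2 <> z).
Hypotheses (y3x : y3 <> x) (y3z : y3 <> z).

(** All four volumes contain the first [n] vectors of the basis adapted to [X], so each is a 2 x 2
    determinant. First coordinates and scale factors cancel, leaving differences of [f]; the next
    vector of that basis has last coordinate 0 and yields the single factors of [f]. *)
Lemma edge_function_first : edge_function 1 Y Z X W d ->
  d = - ((f y3 - f y1) * f y2) / ((f y2 - f y1) * f y3).
Proof.
move=> [a [b [c [t [ha hb hc ht ->]]]]].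
have [szs tkS c0n c1n [D D0 vol]] := weyl_adapted unit_e u_max u_pred hc.
have [a0 [-> a0y a00]] := adapted_head ha Y1.
have [b0 [-> b0y b00]] := adapted_head hb Z1.
have [t0 [-> t0y t00]] := adapted_head ht W1.
rewrite subn1 /= subn1 /= take0 tkS /=.
rewrite -catA /= !volume_outer // !volume_last // !vol c1n.
rewrite !(curve_ratioE frenet_xi xz osc_e ord0 ord_max y1x y1z a0y) -/f.
rewrite !(curve_ratioE frenet_xi xz osc_e ord0 ord_max y2x y2z b0y) -/f.
rewrite !(curve_ratioE frenet_xi xz osc_e ord0 ord_max y3x y3z t0y) -/f.
have := curve_coord_neq0 frenet_xi xz osc_e ord0 y1x y1z a0y a00.
have := curve_coord_neq0 frenet_xi xz osc_e ord0 y2x y2z b0y b00.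
have := curve_coord_neq0 frenet_xi xz osc_e ord0 y3x y3z t0y t00.
move: c0n; set ca := frame_coord e ord0 a0; set cb := frame_coord e ord0 b0.
set ct := frame_coord e ord0 t0; set cc := frame_coord e ord0 _.
move=> cc0 ct0 cb0 ca0.
(* Both volumes of the numerator carry the sign of [volume_outer]. *)
have s2 : (-1) ^+ n * (-1) ^+ n = 1 :> R.
  by rewrite -exprD addnn -mul2n exprM sqrrN !expr1n.
set num := (X in X / _); set den := (X in _ / X).
have -> : num = (ca * cb * ct * cc * D ^+ 2) * (- ((f y3 - f y1) * f y2)).
  by rewrite /num mulrACA s2; ring.
have -> : den = (ca * cb * ct * cc * D ^+ 2) * ((f y2 - f y1) * f y3).
  by rewrite /den; ring.
by rewrite -mulf_div divff ?mul1r // !mulf_neq0.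
Qed.

(** The same reduction with [X] in the first slot; here the single vectors all come last, and no
    sign appears. *)
Lemma edge_function_last : edge_function n.+1 X Y Z W d ->
  d = f y3 * (f y2 - f y1) / (f y1 * (f y3 - f y2)).
Proof.
move=> [a [b [c [t [ha hb hc ht ->]]]]].
have [szs tkS c0n c1n [D D0 vol]] := weyl_adapted unit_e u_max u_pred ha.
have [b0 [-> b0y b00]] := adapted_head hb Y1.
have [c0 [tkc c0y c00]] := adapted_head hc Z1.
have [t0 [-> t0y t00]] := adapted_head ht W1.
rewrite subSnn subnn /= take0 tkc tkS /=.
rewrite -!catA /= !volume_last // !vol c1n.
rewrite !(curve_ratioE frenet_xi xz osc_e ord0 ord_max y1x y1z b0y) -/f.
rewrite !(curve_ratioE frenet_xi xz osc_e ord0 ord_max y2x y2z c0y) -/f.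
rewrite !(curve_ratioE frenet_xi xz osc_e ord0 ord_max y3x y3z t0y) -/f.
have := curve_coord_neq0 frenet_xi xz osc_e ord0 y1x y1z b0y b00.
have := curve_coord_neq0 frenet_xi xz osc_e ord0 y2x y2z c0y c00.
have := curve_coord_neq0 frenet_xi xz osc_e ord0 y3x y3z t0y t00.
move: c0n; set cb := frame_coord e ord0 b0; set cc := frame_coord e ord0 c0.
set ct := frame_coord e ord0 t0; set ca := frame_coord e ord0 _.
move=> ca0 ct0 cc0 cb0.
set num := (X in X / _); set den := (X in _ / X).
have -> : num = (ca * cb * ct * cc * D ^+ 2) * (f y3 * (f y2 - f y1)).
  by rewrite /num; ring.
have -> : den = (ca * cb * ct * cc * D ^+ 2) * (f y1 * (f y3 - f y2)).
  by rewrite /den; ring.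
by rewrite -mulf_div divff ?mul1r // !mulf_neq0.
Qed.

End GapCoordinates.

(** * Conclusion: from fixed points on the circle to the gap formula *)

Lemma weyl_flag1 (R : realType) n (L : 'I_n.+1 -> {vspace 'cV[R]_n.+1}) (u : 'S_n.+1) :
  weyl_flag L u 1 = L (u ord0).
Proof.
rewrite /weyl_flag (big_pred1 ord0) // => i /=.
by rewrite ltnS leqn0.
Qed.

Lemma multiplicative1 (G H : groupType) (f : {multiplicative G -> H}) : f 1%g = 1%g.
Proof. by apply: (mulgI (f 1%g)); rewrite -gmulfM !mulg1. Qed.

Lemma positive_triple_neq (R : realType) (x y z : circle R) :
  positive_triple x y z -> y <> z.
Proof.
move=> [a [b [c [_ yb zc]]]] + yz.
have [s ->] : exists s, b = s *: c by apply: vline_eqP; rewrite -yb -zc yz.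
have -> : volume [:: s *: c; c] = 0 by rewrite volume2 !mxE; ring.
by rewrite mulr0 mul0r ltxx.
Qed.

(** Replacing [m] by [- m] changes the sign of the volume but not the line. *)
Lemma oriented_line (R : realType) (x z : circle R) (p : 'cV[R]_2) : x <> z ->
  val x = <[p]>%VS -> exists2 m, val z = <[m]>%VS & 0 < volume [:: m; p].
Proof.
move=> xz xp; have [m _ zm] := pspace_line z.
have : volume [:: p; m] != 0 by apply: volume_free (circle_free xz xp zm).
rewrite neq_lt volume2 => /orP[lt|gt]; [exists m | exists (- m)] => //.
- by rewrite volume2; move: lt; lra.
- rewrite zm; apply/eqP; rewrite eqEsubv -!memvE; apply/andP; split.
    by rewrite -memvN memv_line.
  by rewrite memvN memv_line.
- by rewrite volume2 !mxE; move: gt; lra.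
Qed.

Theorem theorem10p3p1 (R : realType) (n : nat)
    (G : groupType) (alpha beta gamma : G)
    (hG : pants_group alpha beta gamma)
    (j : {multiplicative G -> psl R 2})
    (am ap bm bp cm cp : circle R)
    (hj : pants_holonomy j alpha beta gamma am ap bm bp cm cp)
    (u v w : 'S_n.+2)
    (hu1 : u ord_max = ord_max) (hu2 : u (inord n) = ord0)
    (hv : v ord0 = ord0) (hw : w ord0 = ord_max)
    (rho : {multiplicative G -> psl R n.+2})
    (hrho : hitchin [set alpha; beta; gamma] rho)
    (xi : circle R -> nat -> {vspace 'cV[R]_n.+2})
    (hxi : associated_frenet j [set (am, ap); (bm, bp); (cm, cp)] rho xi)
    (B : circle R -> circle R -> circle R -> circle R -> R)
    (hB : is_cross_ratio xi B)
    (La Lb Lc : 'I_n.+2 -> {vspace 'cV[R]_n.+2})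
    (hLa : ordered_eigenlines (rho alpha) La)
    (hLb : ordered_eigenlines (rho beta) Lb)
    (hLc : ordered_eigenlines (rho gamma) Lc)
    (C1 Bn1 : R)
    (hC1 : edge_function 1 (weyl_flag Lb v)
             (flag_act (rho alpha) (weyl_flag Lc w))
             (weyl_flag La u) (weyl_flag Lc w) C1)
    (hBn1 : edge_function n.+1 (weyl_flag La u)
              (flag_act (rho alpha)^-1%g (weyl_flag Lb v))
              (weyl_flag Lc w) (weyl_flag Lb v) Bn1)
    (y : circle R) (hy : limit_set j y) (hym : y <> am) (hyp : y <> ap) :
  let l := period B (j alpha) am ap y in
  [/\ 0 < B ap cm am bp,
      0 < (1 + C1 * expR l) / (1 + C1),
      0 < (1 + Bn1) / (Bn1 * (1 + C1)),
      pant_gap B am ap bp cm = ln ((1 + C1 * expR l) / (1 + C1))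
    & ln ((1 + C1 * expR l) / (1 + C1)) =
      ln ((1 + Bn1) / (Bn1 * (1 + C1)))].

Proof.
case: hxi => frenet_xi [G' [i [j' [r' [_ j'E r'E _ equiv']]]]].
(* Equivariance under the group of the double restricts to [G]. *)
have equiv g t k : (k <= n.+2)%N -> xi (pact (j g) t) k = act (rho g) (xi t k).
  by move=> kn; rewrite -j'E -r'E; exact: equiv'.
case: hj => _ fa fb fc cyc.
(* This triple and the next one place [bp] and [cm] on the same arc between [ap] and [am], the one
   that [positive_chart] parametrizes by positive numbers. *)
have apbp : positive_triple am ap bp.
  exact: (cyc (@Ordinal 6 0 isT) (@Ordinal 6 1 isT) (@Ordinal 6 3 isT) isT isT).
have apcm : positive_triple am ap cm.
  exact: (cyc (@Ordinal 6 0 isT) (@Ordinal 6 1 isT) (@Ordinal 6 4 isT) isT isT).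
have bpcm : bp <> cm.
  apply: (@positive_triple_neq _ bm).
  exact: (cyc (@Ordinal 6 2 isT) (@Ordinal 6 3 isT) (@Ordinal 6 4 isT) isT isT).
have apam : ap <> am by case: fa => /nesym.
have [ea osca] := osculating_frame_exists frenet_xi apam.
have [eb oscb] : exists e, osculating_frame xi bp bm e.
  by apply: osculating_frame_exists => //; case: fb => /nesym.
have [ec oscc] : exists e, osculating_frame xi cp cm e.
  by apply: osculating_frame_exists => //; case: fc => /nesym.
have LaE : La = fun k => <[ea k]>%VS.
  by apply/funext; exact: (ordered_eigenlines_osc frenet_xi (equiv alpha) fa osca hLa).
have Lb0 : Lb ord0 = xi bp 1%N.
  exact: (first_eigenline frenet_xi (equiv beta) fb oscb hLb).
have Lcm : Lc ord_max = xi cm 1%N.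
  exact: (last_eigenline frenet_xi (equiv gamma) fc oscc hLc).
have [p _ xp] := pspace_line ap; have [m zm vol] := oriented_line apam xp.
have [c chart] := circle_chart apam xp zm.
have [kappa k0 Ac] := chart_pact fa xp zm chart.
have [tp tp0 bpE] : exists2 t, 0 < t & bp = c t.
  have [t t0 E] := positive_chart apam xp zm vol apbp.
  by exists t => //; apply: val_inj; rewrite chart.
have [tq tq0 cmE] : exists2 t, 0 < t & cm = c t.
  have [t t0 E] := positive_chart apam xp zm vol apcm.
  by exists t => //; apply: val_inj; rewrite chart.
have [bpx bpz] : bp <> ap /\ bp <> am.
  by rewrite bpE; exact: (chart_neq_fixed fa xp zm chart tp0).
have [cmx cmz] : cm <> ap /\ cm <> am.
  by rewrite cmE; exact: (chart_neq_fixed fa xp zm chart tq0).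
have [_ Az Ax _ _] := fa.
pose f := curve_ratio xi ea ord0 ord_max.
pose th := osc_eigenvalue (rho alpha) ea ord_max / osc_eigenvalue (rho alpha) ea ord0.
have /andP[th0 th1] : 0 < th < 1.
  exact: (osc_eigenvalue_ratio frenet_xi (equiv alpha) fa osca).
have f_pact t : t <> ap -> t <> am -> f (pact (j alpha) t) = th * f t.
  exact: (osc_ratio_pact frenet_xi (equiv alpha) fa osca).
have f_inj s t : 0 < s -> 0 < t -> f (c s) = f (c t) -> s = t.
  exact: (chart_ratio_max_inj frenet_xi (equiv alpha) fa osca xp zm chart).
set cm' := pact (j alpha) cm.
set bp' := pact (j alpha)^-1%g bp.
have bp'K : pact (j alpha) bp' = bp by rewrite -pact_mul mulgV pact1.
have cm'x : cm' <> ap by exact: pact_neq_fixed.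
have cm'z : cm' <> am by exact: pact_neq_fixed.
have bp'x : bp' <> ap by move=> h; apply: bpx; rewrite -bp'K h.
have bp'z : bp' <> am by move=> h; apply: bpz; rewrite -bp'K h.
(* alpha cm = beta^-1 gamma^-1 cm = beta^-1 cm, and beta fixes bp. *)
have bpcm' : bp <> cm'.
  move=> h; apply: bpcm; have [rel _] := hG.
  have [_ _ Bp _ _] := fb; have [_ Cm _ _ _] := fc.
  have /= := congr1 (fun g => pact (j g) bp) rel.
  rewrite !gmulfM multiplicative1 !pact_mul pact1 Bp => h1.
  apply: (can_inj (pactK (j gamma))); rewrite Cm.
  by apply: (can_inj (pactK (j alpha))); rewrite h1.
have fpq : 0 < f bp * f cm.
  rewrite bpE cmE.
  exact: (chart_ratio_max_sign frenet_xi fa osca xp zm chart).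
have fpq_neq : f bp != f cm.
  apply/eqP => h; apply: bpcm; rewrite bpE cmE; congr c.
  by apply: f_inj => //; rewrite -bpE -cmE.
have fpq'_neq : f bp != f cm'.
  apply/eqP => h; apply: bpcm'; rewrite bpE /cm' cmE Ac; congr c.
  by apply: f_inj => //; rewrite ?mulr_gt0 // -Ac -bpE -cmE.
rewrite f_pact // in fpq'_neq.
have fbp' : f bp' = f bp / th by rewrite -bp'K f_pact // mulrC mulKf // gt_eqF.
(* The first lines of the three flags other than that of [alpha] lie over [bp], [cm'] and [cm], in
   this order. *)
have C1E : C1 = - ((f cm - f bp) * (th * f cm)) / ((th * f cm - f bp) * f cm).
  rewrite -(f_pact cm) //; rewrite LaE in hC1.
  apply: (edge_function_first frenet_xi apam osca hu1 hu2 _ _ _ _ _ _ _ _ _ hC1) => //.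
  - by rewrite weyl_flag1 hv.
  - by rewrite /flag_act weyl_flag1 hw Lcm -equiv.
  - by rewrite weyl_flag1 hw.
(* Here the first lines lie over [bp'], [cm] and [bp]. *)
have BnE : Bn1 = f bp * (f cm - f bp / th) / (f bp / th * (f bp - f cm)).
  rewrite -fbp'; rewrite LaE in hBn1.
  apply: (edge_function_last frenet_xi apam osca hu1 hu2 _ _ _ _ _ _ _ _ _ hBn1) => //.
  - by rewrite /flag_act weyl_flag1 hv Lb0 -bp'K equiv // -act_mul mulVg act1.
  - by rewrite weyl_flag1 hw.
  - by rewrite weyl_flag1 hv.
have BE : B ap cm am bp = f cm / f bp.
  by have [] := cross_ratioE frenet_xi apam osca hB cmx cmz bpx bpz.
(* Since [alpha] multiplies [f] by [th], the value at [y] cancels. *)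
have expl : expR (period B (j alpha) am ap y) = th^-1.
  have yx' : pact (j alpha) y <> ap by exact: pact_neq_fixed.
  have yz' : pact (j alpha) y <> am by exact: pact_neq_fixed.
  have E : B am (pact (j alpha) y) ap y = f y / f (pact (j alpha) y).
    by have [] := cross_ratioE frenet_xi apam osca hB yx' yz' hyp hym.
  rewrite /period E f_pact //.
  have fy : f y != 0 by exact: (curve_ratio_neq0 frenet_xi apam osca).
  rewrite invfM mulrCA divff // mulr1 gtr0_norm ?invr_gt0 // lnK //.
  by rewrite posrE invr_gt0.
have fp0 : f bp != 0 by apply: contraTneq fpq => ->; rewrite mul0r ltxx.
have fq0 : f cm != 0 by apply: contraTneq fpq => ->; rewrite mulr0 ltxx.
have th_neq0 : th != 0 by rewrite gt_eqF.
have th_neq1 : th - 1 != 0 by rewrite subr_eq0 lt_eqF.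
(* The denominators are nonzero because [bp] differs from [cm'] and from [cm]. *)
have d1 : th * f cm - f bp != 0 by rewrite subr_eq0 eq_sym.
have d2 : f bp - f cm != 0 by rewrite subr_eq0.
have C1S : 1 + C1 = f bp * (th - 1) / (th * f cm - f bp).
  by rewrite C1E; field; rewrite d1 fq0.
have E1 : (1 + C1 * th^-1) / (1 + C1) = f cm / f bp.
  have -> : 1 + C1 * th^-1 = f cm * (th - 1) / (th * f cm - f bp).
    by rewrite C1E; field; rewrite th_neq0 d1 fq0.
  by rewrite C1S; field; rewrite d1 th_neq1 fp0.
have E2 : (1 + Bn1) / (Bn1 * (1 + C1)) = f cm / f bp.
  have -> : Bn1 = (th * f cm - f bp) / (f bp - f cm).
    by rewrite BnE; field; rewrite fp0 th_neq0 d2.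
  by rewrite C1S; field; rewrite d1 d2 fp0 th_neq1.
(* Both points lie on one arc, where [f] keeps its sign. Thus [ln] is applied to positive numbers,
   away from its default values. *)
have pos : 0 < f cm / f bp.
  have -> : f cm / f bp = (f bp * f cm) * (f bp)^-1 ^+ 2 by field.
  by rewrite mulr_gt0 // exprn_even_gt0 //= invr_eq0.
by move=> l; rewrite /pant_gap /l expl E1 E2 BE.
Qed.
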